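(* Let $n \geq 2$ and let $\Omega \subset \mathbb{C}^n$ be a connected, bounded domain of holomorphy. Then the topological boundary $\partial \Omega$ of $\Omega$ in $\mathbb{C}^n$ is connected.
   Context: ''Domain of holomorphy'' has its standard meaning: an open set $\Omega \subset \mathbb{C}^n$ is a domain of holomorphy if there do not exist nonempty open sets $U_1, U_2 \subset \mathbb{C}^n$ such that $U_2$ is connected, $U_2 \not\subset \Omega$, $U_1 \subset U_2 \cap \Omega$, and for every holomorphic function $f$ on $\Omega$ there is a holomorphic function $F$ on $U_2$ with $F = f$ on $U_1$. A set is connected if it is not the union of two disjoint nonempty relatively open subsets (so the empty set is regarded as connected). No smoothness or regularity of the boundary is assumed. *)

(* Defs.v *)
From HB Require Import structures.
From mathcomp Require Import all_boot all_order all_algebra.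
From mathcomp Require Import all_classical all_reals all_analysis.
From mathcomp Require Import complex.

Set Implicit Arguments.
Unset Strict Implicit.
Unset Printing Implicit Defensive.

Import Order.TTheory GRing.Theory Num.Theory.
Import numFieldNormedType.Exports.

Local Open Scope classical_set_scope.
Local Open Scope ring_scope.

(* The topological and normed structures of the library are attached to the
   sort of an abstract [numClosedFieldType], not to [R[i]] itself; stating
   everything over this packed structure makes them available on C and C^n. *)
Definition Cplx (R : realType) : numClosedFieldType := R[i].

Section ComplexSpace.
Context {R : realType} {n : nat}.
Local Notation C := (Cplx R).
Implicit Types (f F : 'rV[C]_n -> C) (A U Omega : set 'rV[C]_n).

Definition boundary A : set 'rV[C]_n := closure A `\` interior A.

(* [differentiable] is Frechet differentiability over the scalar field C, i.e.
   the differential is C-linear.  Functions are total; this is only used for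
   open [U], where differentiability at the points of [U] does not depend on
   the values taken outside of [U]. *)
Definition holomorphic_on U f := forall z, U z -> differentiable f z.

Definition domain_of_holomorphy Omega :=
  open Omega /\
  ~ exists U1 U2 : set 'rV[C]_n,
      [/\ open U1 /\ U1 !=set0, open U2 /\ U2 !=set0,
          connected U2 /\ ~ (U2 `<=` Omega),
          U1 `<=` U2 `&` Omega &
          forall f, holomorphic_on Omega f ->
            exists F, holomorphic_on U2 F /\ (forall z, U1 z -> F z = f z)].

End ComplexSpace.

(* Main.v *)
From HB Require Import structures.
Require Import Defs.
From mathcomp Require Import all_boot all_order all_algebra.
From mathcomp Require Import all_classical all_reals all_analysis.
From mathcomp Require Import complex ring lra.
Import Order.TTheory GRing.Theory Num.Theory.
Import numFieldNormedType.Exports.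
Local Open Scope classical_set_scope.
Local Open Scope ring_scope.
Set Implicit Arguments.
Unset Strict Implicit.
Unset Printing Implicit Defensive.

(** Suppose that the boundary of [Omega] is the union of two disjoint nonempty
closed sets [K1] and [K2]; both are compact, hence at a positive distance.

Topology.  Let [chi] be 1 near [K1] and 0 elsewhere.  The increments of [chi]
between nearby points of [Omega], extended by 0 to the pairs of points that
are not both in [Omega], form a cocycle at a small scale ([jump_cocycle]):
when a point outside [Omega] is close, all the points of [Omega] close to it
see the same piece of the boundary.  The space being simply connected, this
cocycle has a primitive, the [height], obtained by summing increments along
rays that end far away from [Omega] ([heightB]).  The height is locally
constant off [Omega], and its difference with [chi] is constant on the
connected set [Omega]; so its values on [K1] and on [K2] differ by 1, and one
of them is not zero.

An exposed point.  The height is zero at the points whose ray misses [Omega].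
Hence the points outside [Omega] at a given nonzero height form a closed set on
which the function [Re z_0 + |z_1|^2] reaches a maximum, at [q] say.  Close to
[q], every point where this function is larger lies in [Omega].

Hartogs.  That function is strictly plurisubharmonic along a complex line which
is tangent at [q] to its level set: on small circles of this line, and of
its translates, it exceeds its value at [q].  The circles are therefore inside
[Omega], and the Cauchy integrals over them extend every holomorphic function
to a full neighbourhood of [q] ([hartogs_extension]).  As [q] is not in
[Omega], this contradicts that [Omega] is a domain of holomorphy.  So the height
is zero on the whole boundary ([height_eq0]), which is absurd since its values on
[K1] and [K2] are different.

One variable.  Holomorphic functions are only known to be differentiable at
each point, so this rests on Goursat's lemma.  Contour integrals are
replaced by dyadic trapezoidal sums along segments: they are exactly additive
under bisection, which is all that the proof by subdivision needs ([goursat]).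
Cauchy's formula takes the form of a limit of means over the [2^m]-th roots of
unity ([cauchy_formula]); it bounds the remainder of order two of a holomorphic
function by its supremum ([taylor2]), so a pointwise limit of uniformly bounded
holomorphic functions is holomorphic ([ultralimit_differentiable]).  Taking
the limit along an ultrafilter gives the extension at once: that the means
converge only has to be known where they converge to the given function. *)

(** * Real-valued norms *)

Section RealNorm.
Context {R : realType}.
Local Notation C := (Cplx R).

(** The order of the complex numbers is partial; reading norms in [R] makes
real linear arithmetic available for all the estimates. *)
Definition nrm {V : normedModType C} (x : V) : R := complex.Re `|x|.

Definition rC (t : R) : C := (t%:C)%C.

Lemma rC_rmorph : GRing.zmod_morphism rC * GRing.monoid_morphism rC.
Proof.
by split; [exact: rmorphB|split; [exact: rmorph1|exact: rmorphM]].
Qed.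

HB.instance Definition _ := GRing.isZmodMorphism.Build R C rC rC_rmorph.1.
HB.instance Definition _ := GRing.isMonoidMorphism.Build R C rC rC_rmorph.2.

Lemma ler_rC s t : (rC s <= rC t) = (s <= t).
Proof. exact: lecR. Qed.

Lemma ltr_rC s t : (rC s < rC t) = (s < t).
Proof. exact: ltcR. Qed.

Lemma rC_ge0 (e : C) : 0 <= e -> e = rC (complex.Re e).
Proof. by move=> /ger0_Im; case: e => a b /= ->. Qed.

Lemma rC_gt0 (e : C) : 0 < e -> e = rC (complex.Re e) /\ 0 < complex.Re e.
Proof.
move=> e0; have E := rC_ge0 (ltW e0); split=> //.
by rewrite -ltr_rC -E rmorph0.
Qed.

Section Vector.
Context {V : normedModType C}.
Implicit Types x y : V.

Lemma normE x : `|x| = rC (nrm x).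
Proof. exact: rC_ge0 (normr_ge0 x). Qed.

Lemma nrm_ge0 x : 0 <= nrm x.
Proof. by rewrite -ler_rC -normE rmorph0. Qed.

Lemma nrm0 : nrm (0 : V) = 0.
Proof. by rewrite /nrm normr0. Qed.

Lemma nrm_eq0 x : (nrm x == 0) = (x == 0).
Proof.
by rewrite -[RHS]normr_eq0 normE -(inj_eq (@complexI R)) /=.
Qed.

Lemma nrm_gt0 x : (0 < nrm x) = (x != 0).
Proof. by rewrite lt_neqAle nrm_ge0 andbT eq_sym nrm_eq0. Qed.

Lemma nrmN x : nrm (- x) = nrm x.
Proof. by rewrite /nrm normrN. Qed.

Lemma nrmB x y : nrm (x - y) = nrm (y - x).
Proof. by rewrite /nrm distrC. Qed.

Lemma nrmD x y : nrm (x + y) <= nrm x + nrm y.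
Proof. by rewrite -ler_rC rmorphD /= -!normE ler_normD. Qed.

Lemma nrm_triB x y z : nrm (x - z) <= nrm (x - y) + nrm (y - z).
Proof. by rewrite -ler_rC rmorphD /= -!normE ler_distD. Qed.

Lemma nrmZ (a : C) x : nrm (a *: x) = nrm a * nrm x.
Proof.
apply: (@complexI R); rewrite -[LHS]/(rC _) -[RHS]/(rC _) rmorphM /=.
by rewrite -!normE normrZ.
Qed.

Lemma nrm_sum (I : Type) (r : seq I) (P : pred I) (F : I -> V) :
  nrm (\sum_(i <- r | P i) F i) <= \sum_(i <- r | P i) nrm (F i).
Proof.
elim/big_rec2: _ => [|i y x _ h]; first by rewrite nrm0.
by rewrite (le_trans (nrmD _ _))// lerD2l.
Qed.

Lemma nbhs_nrm x (A : set V) :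
  nbhs x A <-> exists2 d : R, 0 < d & forall y, nrm (y - x) < d -> A y.
Proof.
split=> [/nbhs_normP[e /= e0 eA]|[d d0 dA]].
  have [eE e0'] := rC_gt0 e0.
  exists (complex.Re e) => // y yx; apply: eA => /=.
  by rewrite normE eE ltr_rC nrmB.
apply/nbhs_normP; exists (rC d) => /=; first by rewrite -(rmorph0 rC) ltr_rC.
by move=> y /=; rewrite normE ltr_rC nrmB; exact: dA.
Qed.

End Vector.

Lemma nrmM (a b : C) : nrm (a * b) = nrm a * nrm b.
Proof. exact: (@nrmZ C). Qed.

Lemma nrm1 : nrm (1 : C) = 1.
Proof. by rewrite /nrm normr1. Qed.

Lemma nrmV (a : C) : nrm a^-1 = (nrm a)^-1.
Proof.
have [->|a0] := eqVneq a 0; first by rewrite invr0 nrm0 invr0.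
apply: (mulIf (x := nrm a)); first by rewrite nrm_eq0.
by rewrite -nrmM !mulVf ?nrm_eq0// nrm1.
Qed.

Lemma nrmX (a : C) n : nrm (a ^+ n) = nrm a ^+ n.
Proof. by elim: n => [|n ih]; rewrite ?nrm1// !exprS nrmM ih. Qed.

Lemma nrm_rC t : nrm (rC t) = `|t|.
Proof. by rewrite /nrm normc_def /= expr0n /= addr0 sqrtr_sqr. Qed.

Lemma nrm_nat n : nrm (n%:R : C) = n%:R.
Proof. by rewrite /nrm normr_nat -(rmorph_nat rC). Qed.

Lemma nrm_sqr (a : C) : nrm a ^+ 2 = complex.Re a ^+ 2 + complex.Im a ^+ 2.
Proof. by rewrite /nrm normc_def /= sqr_sqrtr// addr_ge0// sqr_ge0. Qed.

Lemma nrm_Re (a : C) : `|complex.Re a| <= nrm a.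
Proof. by rewrite -ler_rC -normE; exact: normc_ge_Re. Qed.

Lemma nrm_Im (a : C) : `|complex.Im a| <= nrm a.
Proof.
rewrite -(@ler_pXn2r _ 2)// ?nnegrE ?nrm_ge0// nrm_sqr real_normK ?num_real//.
by rewrite lerDr sqr_ge0.
Qed.

Lemma nrm_le_ReIm (a : C) : nrm a <= `|complex.Re a| + `|complex.Im a|.
Proof.
rewrite -(@ler_pXn2r _ 2)// ?nnegrE ?nrm_ge0 ?addr_ge0// nrm_sqr.
rewrite sqrrD !real_normK ?num_real// lerD2r lerDl.
by rewrite mulrn_wge0// mulr_ge0.
Qed.

Lemma nrm_coord n (x : 'rV[C]_n) i : nrm (x ord0 i) <= nrm x.
Proof.
rewrite -ler_rC -!normE [leRHS]/Num.norm/= mx_normE.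
rewrite -[leLHS]nngE num_le.
exact: (le_bigmax _ (fun j : 'I_1 * 'I_n => `|x j.1 j.2|%:nng) (ord0, i)).
Qed.

Lemma nrm_rV_lt n (x : 'rV[C]_n) (e : R) :
  0 < e -> (forall i, nrm (x ord0 i) < e) -> nrm x < e.
Proof.
move=> e0 xe; rewrite -ltr_rC -normE.
have : ball (0 : 'rV[C]_n) (rC e) (- x).
  split=> [|i j]; first by rewrite -(rmorph0 rC) ltr_rC.
  by rewrite (ord1 i) /= /ball/= !mxE sub0r opprK normE ltr_rC.
by rewrite -ball_normE /= sub0r opprK.
Qed.

Lemma nrm_rV_le n (x : 'rV[C]_n) (e : R) :
  0 <= e -> (forall i, nrm (x ord0 i) <= e) -> nrm x <= e.
Proof.
move=> e0 xe; apply/ler_addgt0Pr => d d0; apply/ltW/nrm_rV_lt => [|i].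
  by rewrite ltr_wpDl.
by rewrite (le_lt_trans (xe i))// ltrDl.
Qed.

Lemma nrm_delta_le1 n (i0 : 'I_n) : nrm (delta_mx ord0 i0 : 'rV[C]_n) <= 1.
Proof.
by apply: nrm_rV_le => // j; rewrite mxE /=; case: (j == i0); rewrite ?nrm1 ?nrm0.
Qed.

End RealNorm.

(** * Compactness, connectedness and convexity in complex normed spaces *)
Section Topology.
Context {R : realType}.
Local Notation C := (Cplx R).

Lemma cvg_nrm {V W : normedModType C} (f : V -> W) (x : V) :
  f @ x --> f x <-> forall e : R, 0 < e -> exists2 d : R, 0 < d &
    forall y, nrm (y - x) < d -> nrm (f y - f x) < e.
Proof.
split=> [cf e e0|H A].
  have : nbhs (f x) [set w | nrm (w - f x) < e].
    by apply/nbhs_nrm; exists e.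
  by move=> /cf /nbhs_nrm.
move=> /nbhs_nrm[e e0 eA]; have [d d0 dH] := H e e0.
by apply/nbhs_nrm; exists d => // y /dH; exact: eA.
Qed.

Lemma nrm_continuous {V : normedModType C} : continuous (nrm : V -> R).
Proof.
move=> x A /nbhs_ballP[e /= e0 eA].
apply/(@nbhs_nrm R V x (nrm @^-1` A)); exists e => // y yx; apply: eA.
rewrite /ball/= (le_lt_trans _ yx)// ler_norml.
have := nrm_triB x y 0; have := nrm_triB y x 0; rewrite !subr0 nrmB; lra.
Qed.

Lemma Re_continuous : continuous (@complex.Re R : C -> R).
Proof.
move=> x A /nbhs_ballP[e /= e0 eA].
apply/(@nbhs_nrm R C x (@complex.Re R @^-1` A)); exists e => // y yx; apply: eA.
rewrite /ball/= (le_lt_trans _ yx)// nrmB.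
by apply: le_trans (nrm_Re _); case: (x) (y) => [a b] [c d].
Qed.

Lemma rC_continuous : continuous (rC : R -> C).
Proof.
move=> x A /nbhs_nrm[e e0 eA]; apply/nbhs_ballP; exists e => //= y.
by rewrite /ball/= => yx; apply: eA; rewrite -rmorphB /= nrm_rC distrC.
Qed.

(** The disk is a closed part of the image of a square of [R * R]. *)
Lemma disk_compact (r : R) : compact [set z : C | nrm z <= r].
Proof.
pose f (p : R * R) : C := rC p.1 + 'i * rC p.2.
have cf : continuous f.
  move=> p; apply: cvgD; first by apply: continuous_comp; [exact: cvg_fst|exact: rC_continuous].
  by apply: cvgMr; apply: continuous_comp; [exact: cvg_snd|exact: rC_continuous].
have K : compact (f @` (`[-r, r] `*` `[-r, r])).
  apply: continuous_compact; first exact: continuous_subspaceT.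
  by apply: compact_setX; exact: segment_compact.
apply: subclosed_compact K _.
  rewrite [X in closed X](_ : _ = nrm @^-1` [set x | x <= r]).
    by apply: closed_comp; [move=> ? _; exact: nrm_continuous|exact: closed_le].
  by [].
move=> z /= zr; exists (complex.Re z, complex.Im z) => /=.
  rewrite !in_itv/= -!ler_norml.
  by rewrite !(le_trans _ zr) ?nrm_Re ?nrm_Im.
by rewrite /f [RHS]complexE.
Qed.

Lemma closed_bounded_compact n (A : set 'rV[C]_n) (r : R) :
  closed A -> (forall x, A x -> nrm x <= r) -> compact A.
Proof.
move=> cA Ar.
have := @rV_compact C n (fun=> [set z : C | nrm z <= r]) (fun=> @disk_compact r).
move=> /subclosed_compact; apply=> // x /Ar xr i /=.
exact: le_trans (nrm_coord _ _) xr.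
Qed.

(** The Lebesgue number argument behind boundedness and uniform continuity on compact
sets, and behind the distance between disjoint closed sets. *)
Lemma compact_uniform {V : normedModType C} (A : set V) (P : R -> V -> Prop) :
  compact A ->
  (forall x, A x -> exists2 d : R, 0 < d &
     forall y e, nrm (y - x) < d -> 0 < e < d -> P e y) ->
  exists2 d : R, 0 < d & forall x, A x -> P d x.
Proof.
move=> /compact_near_coveringP cA AP.
have H : forall x, A x -> \forall y \near x & e \near (0:R)^'+, P e y.
  move=> x /AP[d d0 dP].
  exists ([set y | nrm (y - x) < d], [set e | 0 < e < d]) => /=.
    split=> /=; first by apply/nbhs_nrm; exists d.
    near=> e; apply/andP; split; near: e; first exact: nbhs_right_gt.
    exact: nbhs_right_lt.
  by move=> [y e] /= [? ?]; exact: dP.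
have [d [d0 dP]] : exists d : R, 0 < d /\ A `<=` P d.
  near (0:R)^'+ => d; exists d; split; first by near: d; exact: nbhs_right_gt.
  near: d; exact: cA H.
by exists d.
Unshelve. all: by end_near. Qed.

Lemma bounded_nrm {V : normedModType C} (A : set V) :
  bounded_set A -> exists r : R, forall x, A x -> nrm x <= r.
Proof.
move=> [M [/RRe_real ME H]]; exists (complex.Re M + 1) => x Ax.
by rewrite -ler_rC -normE; apply: H => //; rewrite -ME ltcR ltrDl.
Qed.

(** A convex set is the union of the segments issued from one of its points. *)
Lemma convex_connected {V : normedModType C} (A : set V) :
  (forall x y (t : R), A x -> A y -> 0 <= t <= 1 -> A (x + rC t *: (y - x))) ->
  connected A.
Proof.
move=> cA; have [->|/set0P[x Ax]] := eqVneq A set0; first exact: connected0.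
pose seg y (t : R) : V := x + rC t *: (y - x).
have -> : A = \bigcup_(y in A) (seg y @` `[0, 1]).
  apply/seteqP; split=> [y Ay|z [y Ay [t t01 <-]]].
    exists y => //; exists 1 => /=; first by rewrite in_itv/= ler01 lexx.
    by rewrite /seg rmorph1 scale1r addrC subrK.
  by move: t01; rewrite /= in_itv /= => t01; exact: cA.
apply: bigcup_connected => [|y Ay].
  exists x => y Ay; exists 0; first by rewrite /= in_itv/= ler01 lexx.
  by rewrite /seg rmorph0 scale0r addr0.
apply: connected_continuous_connected; first exact: segment_connected.
apply: continuous_subspaceT => t; apply: cvgD; first exact: cvg_cst.
by apply: cvgZl; exact: rC_continuous.
Qed.

Lemma nrm_lipschitz_continuous {V W : normedModType C} (g : V -> W) (L : R) :
  (forall x y : V, nrm (g y - g x) <= L * nrm (y - x)) -> continuous g.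
Proof.
move=> gL x; apply/(cvg_nrm g) => e e0.
have L0 : 0 < `|L| + 1 by rewrite ltr_wpDl.
exists (e / (`|L| + 1)); first by rewrite divr_gt0.
move=> y; rewrite ltr_pdivlMr// => h; apply: le_lt_trans (gL _ _) _.
apply: le_lt_trans h; rewrite mulrC ler_wpM2l ?nrm_ge0//.
by rewrite (le_trans (ler_norm L))// lerDl.
Qed.

Lemma open_lt_continuous {V : normedModType C} (g : V -> R) (r : R) :
  continuous g -> open [set x | g x < r].
Proof.
move=> cg; rewrite [X in open X](_ : _ = g @^-1` [set t | t < r])//.
by apply: open_comp; [move=> ? _; exact: cg|exact: open_lt].
Qed.

Lemma closed_le_continuous {V : normedModType C} (g : V -> R) (r : R) :
  continuous g -> closed [set x | g x <= r].
Proof.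
move=> cg; rewrite [X in closed X](_ : _ = g @^-1` [set t | t <= r])//.
by apply: closed_comp; [move=> ? _; exact: cg|exact: closed_le].
Qed.

Lemma closed_ge_continuous {V : normedModType C} (g : V -> R) (r : R) :
  continuous g -> closed [set x | r <= g x].
Proof.
move=> cg; rewrite [X in closed X](_ : _ = g @^-1` [set t | r <= t])//.
by apply: closed_comp; [move=> ? _; exact: cg|exact: closed_ge].
Qed.

Lemma compact_image_bounded {V : normedModType C} (A : set V) (k : V -> C) :
  compact A ->
  (forall x : V, A x -> forall e : R, 0 < e -> exists2 d : R, 0 < d &
     forall y, nrm (y - x) < d -> nrm (k y - k x) < e) ->
  exists B : R, forall x, A x -> nrm (k x) <= B.
Proof.
move=> cA kc.
have [|b b0 Hb] := compact_uniform (P := fun e y => nrm (k y) <= e^-1) cA.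
  move=> x xs; have [del del0 H] := kc x xs 1 ltr01.
  have n0 : 0 < nrm (k x) + 1 by rewrite ltr_wpDl ?nrm_ge0.
  exists (Num.min del (nrm (k x) + 1)^-1); first by rewrite lt_min del0 invr_gt0.
  move=> y e; rewrite !lt_min => /andP[/H h _] /and3P[e0 _ he].
  have : nrm (k x) + 1 <= e^-1 by rewrite -[leLHS]invrK lef_pV2 ?posrE ?invr_gt0// ltW.
  have := nrmD (k y - k x) (k x); rewrite subrK; lra.
by exists b^-1.
Qed.

Lemma compact_uniformly_continuous {V : normedModType C} (A : set V) (k : V -> C) :
  compact A ->
  (forall x : V, A x -> forall e : R, 0 < e -> exists2 d : R, 0 < d &
     forall y, nrm (y - x) < d -> nrm (k y - k x) < e) ->
  forall e : R, 0 < e -> exists2 d : R, 0 < d & forall x, A x ->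
    forall y, nrm (y - x) < d -> nrm (k y - k x) < e.
Proof.
move=> cA kc e e0; have e2 : 0 < e / 2 by rewrite divr_gt0.
apply: (compact_uniform (P := fun d x =>
  forall y, nrm (y - x) < d -> nrm (k y - k x) < e) cA) => x Ax.
have [del del0 H] := kc x Ax _ e2.
exists (del / 2); first by rewrite divr_gt0.
move=> y d yx /andP[d0 d1] z zy.
have h1 : nrm (y - x) < del by lra.
have h2 : nrm (z - x) < del by have := nrm_triB z y x; lra.
have := nrm_triB (k z) (k x) (k y); rewrite (nrmB (k x) (k y)).
have := H _ h1; have := H _ h2; lra.
Qed.

Lemma convex_nrm_le {V : normedModType C} (a b : V) (t r : R) : 0 <= t <= 1 ->
  nrm a <= r -> nrm b <= r -> nrm (a + rC t *: (b - a)) <= r.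
Proof.
move=> /andP[t0 t1] ar br.
have -> : a + rC t *: (b - a) = rC (1 - t) *: a + rC t *: b.
  by rewrite rmorphB rmorph1 /= scalerBl scale1r scalerBr addrA addrAC.
apply: le_trans (nrmD _ _) _; rewrite !nrmZ !nrm_rC !ger0_norm ?subr_ge0//.
have t1' : 0 <= 1 - t by rewrite subr_ge0.
by have := ler_wpM2l t0 br; have := ler_wpM2l t1' ar; lra.
Qed.

Lemma convex_nrm_lt {V : normedModType C} (a b : V) (t r : R) : 0 <= t <= 1 ->
  nrm a < r -> nrm b < r -> nrm (a + rC t *: (b - a)) < r.
Proof.
move=> t01 ar br.
have := @convex_nrm_le _ a b t (Num.max (nrm a) (nrm b)) t01.
move=> /(_ _ _)/le_lt_trans; apply; first by rewrite le_max lexx.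
  by rewrite le_max lexx orbT.
by rewrite gt_max ar br.
Qed.

Lemma closure_nrm {V : normedModType C} (A : set V) x (e : R) : closure A x -> 0 < e ->
  exists2 y, A y & nrm (y - x) < e.
Proof.
move=> clx e0; have [|y [Ay yx]] := clx [set y | nrm (y - x) < e]; last by exists y.
by apply/nbhs_nrm; exists e.
Qed.

End Topology.

(** * Trapezoidal sums and Goursat's lemma *)
Section Goursat.
Context {R : realType}.
Local Notation C := (Cplx R).
Implicit Types (a b c p : C) (k : C -> C) (D : set C).

Definition midpoint a b : C := (a + b) / 2.

(** The trapezoidal sum of [k] over the [2^m] equal parts of the segment from [a]
to [b].  The recursion on midpoints makes it additive under bisection, from one
depth to the next. *)
Fixpoint trapez k m a b : C :=
  if m is m'.+1 then
    trapez k m' a (midpoint a b) + trapez k m' (midpoint a b) b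
  else (k a + k b) / 2 * (b - a).

Definition triangle_sum k m a b c : C :=
  trapez k m a b + trapez k m b c + trapez k m c a.

(** Bisection only produces midpoints, so this weak form of convexity is enough,
and it is immediate for disks and half-planes. *)
Definition midconvex D := forall a b, D a -> D b -> D (midpoint a b).

Lemma midpointC a b : midpoint a b = midpoint b a.
Proof. by rewrite /midpoint addrC. Qed.

Lemma trapez_sym k m a b : trapez k m b a = - trapez k m a b.
Proof.
elim: m a b => [|m ih] a b /=; first by rewrite (addrC (k b)) -mulrN opprB.
by rewrite midpointC addrC [X in X + _]ih [X in _ + X]ih opprD.
Qed.

Lemma midpointBl a b : midpoint a b - a = (b - a) / 2.
Proof. by rewrite /midpoint; field. Qed.

Lemma midpointBr a b : b - midpoint a b = (b - a) / 2.
Proof. by rewrite /midpoint; field. Qed.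

Lemma nrm_half a : nrm (a / 2) = nrm a / 2.
Proof. by rewrite nrmM nrmV nrm_nat. Qed.

(** The trapezoidal rule is exact on affine functions, with primitive
[al x + be x^2 / 2]; the error is therefore that of approximating [k] by an
affine function. *)
Lemma trapez_affine k D (al be : C) (eta : R) m a b : midconvex D ->
  (forall x, D x -> nrm (k x - (al + be * x)) <= eta) -> D a -> D b ->
  nrm (trapez k m a b -
    ((al * b + be * b ^+ 2 / 2) - (al * a + be * a ^+ 2 / 2))) <=
  eta * nrm (b - a).
Proof.
move=> cD kD; elim: m a b => [|m ih] a b Da Db /=.
  rewrite [X in nrm X](_ : _ =
    ((k a - (al + be * a)) + (k b - (al + be * b))) / 2 * (b - a)); last by field.
  rewrite nrmM ler_wpM2r ?nrm_ge0// nrm_half.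
  have := nrmD (k a - (al + be * a)) (k b - (al + be * b)).
  by have := kD _ Da; have := kD _ Db; lra.
have Dm := cD _ _ Da Db.
have := ih _ _ Da Dm; have := ih _ _ Dm Db.
rewrite midpointBl midpointBr nrm_half => h1 h2.
set H := fun x => al * x + be * x ^+ 2 / 2.
rewrite [X in nrm X](_ : _ =
  (trapez k m a (midpoint a b) - (H (midpoint a b) - H a)) +
  (trapez k m (midpoint a b) b - (H b - H (midpoint a b)))); last by rewrite /H; ring.
apply: le_trans (nrmD _ _) _; rewrite /H.
by move: h1 h2; rewrite mulrA; lra.
Qed.

(** Each inner edge is run along twice, in opposite directions. *)
Lemma triangle_split k m a b c :
  triangle_sum k m.+1 a b c =
  triangle_sum k m a (midpoint a b) (midpoint a c) +
  triangle_sum k m (midpoint a b) b (midpoint b c) +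
  triangle_sum k m (midpoint a c) (midpoint b c) c +
  triangle_sum k m (midpoint a b) (midpoint b c) (midpoint a c).
Proof.
rewrite /triangle_sum /= (midpointC c a).
rewrite (trapez_sym k m (midpoint a b) (midpoint b c)).
rewrite (trapez_sym k m (midpoint b c) (midpoint a c)).
rewrite (trapez_sym k m (midpoint a b) (midpoint a c)).
ring.
Qed.

Lemma triangle_affine k D (al be : C) (eta r : R) m a b c : midconvex D ->
  (forall x, D x -> nrm (k x - (al + be * x)) <= eta) -> 0 <= eta ->
  D a -> D b -> D c ->
  nrm (b - a) <= r -> nrm (c - b) <= r -> nrm (a - c) <= r ->
  nrm (triangle_sum k m a b c) <= 3 * (eta * r).
Proof.
move=> cD kD eta0 Da Db Dc ab bc ca.
have h1 := trapez_affine m cD kD Da Db.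
have h2 := trapez_affine m cD kD Db Dc.
have h3 := trapez_affine m cD kD Dc Da.
have {}ab := ler_wpM2l eta0 ab.
have {}bc := ler_wpM2l eta0 bc.
have {}ca := ler_wpM2l eta0 ca.
set H := fun x => al * x + be * x ^+ 2 / 2.
rewrite [X in nrm X](_ : _ =
  (trapez k m a b - (H b - H a)) + (trapez k m b c - (H c - H b)) +
  (trapez k m c a - (H a - H c))); last by rewrite /H /triangle_sum; ring.
apply: le_trans (nrmD _ _) _.
have := nrmD (trapez k m a b - (H b - H a)) (trapez k m b c - (H c - H b)).
by rewrite /H; lra.
Qed.

Lemma ball_midconvex p (r : R) : midconvex [set x | nrm (x - p) <= r].
Proof.
move=> a b /= ar br.
rewrite (_ : _ - p = (a - p) / 2 + (b - p) / 2); last by rewrite /midpoint; field.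
by rewrite (le_trans (nrmD _ _))// !nrm_half; lra.
Qed.

Definition cderivable k p := exists d : C, forall e : R, 0 < e ->
  exists2 del : R, 0 < del & forall x, nrm (x - p) < del ->
    nrm (k x - k p - d * (x - p)) <= e * nrm (x - p).

Definition vanishes (u : nat -> C) :=
  forall e : R, 0 < e -> exists M, forall m, (M <= m)%N -> nrm (u m) < e.

Definition triple : Type := C * C * C.
Definition tsum k m (t : triple) := triangle_sum k m t.1.1 t.1.2 t.2.
(** The failure of the sums to be eventually less than [e], in the form that passes
to one of the four quarters of the triangle. *)
Definition often k (e : R) (t : triple) :=
  forall M, exists2 m, (M <= m)%N & e <= nrm (tsum k m t).
Definition inside D (t : triple) := [/\ D t.1.1, D t.1.2 & D t.2].
Definition sides (r : R) (t : triple) :=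
  [/\ nrm (t.1.2 - t.1.1) <= r, nrm (t.2 - t.1.2) <= r & nrm (t.1.1 - t.2) <= r].

Definition quarter (t : triple) (i : 'I_4) : triple :=
  let: (a, b, c) := t in
  nth t [:: (a, midpoint a b, midpoint a c);
            (midpoint a b, b, midpoint b c);
            (midpoint a c, midpoint b c, c);
            (midpoint a b, midpoint b c, midpoint a c)] i.

Lemma tsum_quarter k m t : tsum k m.+1 t = \sum_(i < 4) tsum k m (quarter t i).
Proof.
case: t => [[a b] c]; rewrite !big_ord_recr big_ord0 /= add0r.
exact: triangle_split.
Qed.

(** If the four quarters were eventually below [e / 4], their sum would eventually
be below [e]. *)
Lemma often_quarter k e t : often k e t -> exists i, often k (e / 4) (quarter t i).
Proof.
move=> oe; apply: contrapT => /forallNP no.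
have /choice[M HM] : forall i, exists M, forall m, (M <= m)%N ->
    nrm (tsum k m (quarter t i)) < e / 4.
  move=> i; have /existsNP[M HM] := no i.
  exists M => m Mm; rewrite ltNge; apply/negP => h.
  by apply: HM; exists m.
have [m] := oe (\max_i M i).+1.
case: m => // m Mm; apply/negP; rewrite -ltNge tsum_quarter.
apply: le_lt_trans (nrm_sum _ _ _) _.
have -> : e = \sum_(i < 4) e / 4.
  by rewrite sumr_const card_ord; field.
apply: ltr_sum => [|i _]; first by apply/hasP; exists ord0; rewrite ?mem_index_enum.
by apply: HM; apply: leq_trans (_ : \max_i M i <= m)%N => //; exact: leq_bigmax.
Qed.

Lemma inside_quarter D t i : midconvex D -> inside D t -> inside D (quarter t i).
Proof.
case: t => [[a b] c] cD [/= Da Db Dc].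
have ? := cD _ _ Da Db; have ? := cD _ _ Da Dc; have ? := cD _ _ Db Dc.
by case: i => [[|[|[|[|//]]]] ?]; split.
Qed.

Lemma sides_quarter r t i : sides r t -> sides (r / 2) (quarter t i).
Proof.
case: t => [[a b] c] [/= ab bc ca].
have h' (x y : C) : nrm (x - y) <= r -> nrm ((x - y) / 2) <= r / 2.
  by rewrite nrm_half => ?; rewrite ler_pM2r// invr_gt0.
have h2 (x y : C) : nrm (x - y) <= r -> nrm ((y - x) / 2) <= r / 2.
  by rewrite nrm_half nrmB => ?; rewrite ler_pM2r// invr_gt0.
have f (x y z w : C) : nrm (x - y) <= r -> z - w = (x - y) / 2 -> nrm (z - w) <= r / 2.
  by move=> + ->; exact: h'.
have f' (x y z w : C) : nrm (x - y) <= r -> z - w = (y - x) / 2 -> nrm (z - w) <= r / 2.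
  by move=> + ->; exact: h2.
case: i => [[|[|[|[|//]]]] ?]; split=> /=;
 solve [apply: (f b a) => //; by rewrite /midpoint; field
 | apply: (f' b a) => //; by rewrite /midpoint; field
 | apply: (f c b) => //; by rewrite /midpoint; field
 | apply: (f' c b) => //; by rewrite /midpoint; field
 | apply: (f a c) => //; by rewrite /midpoint; field
 | apply: (f' a c) => //; by rewrite /midpoint; field].
Qed.

Lemma apex_quarter r t i : sides r t -> nrm ((quarter t i).1.1 - t.1.1) <= r.
Proof.
case: t => [[a b] c] [/= ab bc ca].
have r0 : 0 <= r by apply: le_trans ab; exact: nrm_ge0.
have hb : nrm (midpoint a b - a) <= r by rewrite midpointBl nrm_half; lra.
have hc : nrm (midpoint a c - a) <= r.
  by rewrite midpointBl nrm_half nrmB; lra.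
by case: i => [[|[|[|[|//]]]] ?] //=; rewrite subrr nrm0.
Qed.

(** Otherwise bisection gives nested triangles [T i] of size [r / 2^i] whose sums
are at least [e / 4^i] infinitely often.  They shrink to a point [p]; there [k]
is affine up to [o(2^-i)], so the sums over [T i] are [o(4^-i)]. *)
Lemma goursat k D a b c : compact D -> midconvex D ->
  (forall p, D p -> cderivable k p) -> D a -> D b -> D c ->
  vanishes (fun m => triangle_sum k m a b c).
Proof.
move=> kD cD dD Da Db Dc e e0; apply: contrapT => /forallNP no.
have oe : often k e (a, b, c).
  move=> M; have /existsNP[m /not_implyP[Mm /negP]] := no M.
  by rewrite -leNgt => ?; exists m.
have /choice[nxt Hnxt] : forall te : triple * R, exists i,
    often k te.2 te.1 -> often k (te.2 / 4) (quarter te.1 i).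
  move=> [t e'] /=; have [/often_quarter[i ?]|?] := pselect (often k e' t).
    by exists i.
  by exists ord0.
(* the quarter selected at step i depends on the threshold e / 4^i *)
pose T := fix T i : triple :=
  if i is i'.+1 then quarter (T i') (nxt (T i', e / 4 ^+ i')) else (a, b, c).
have oT i : often k (e / 4 ^+ i) (T i).
  elim: i => [|i ih]; first by rewrite expr0 divr1.
  by rewrite exprSr invfM mulrA; exact: (Hnxt (T i, _)).
have iT i : inside D (T i).
  by elim: i => [|i ih]; [split|exact: inside_quarter].
pose r := 1 + nrm (b - a) + nrm (c - b) + nrm (a - c).
have r0 : 0 < r.
  by rewrite /r; have := nrm_ge0 (b-a); have := nrm_ge0 (c-b); have := nrm_ge0 (a-c); lra.
have sT i : sides (r / 2 ^+ i) (T i).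
  elim: i => [|i ih]; last by rewrite exprSr invfM mulrA; exact: sides_quarter.
  rewrite expr0 divr1 /sides/= /r.
  have := nrm_ge0 (b-a); have := nrm_ge0 (c-b); have := nrm_ge0 (a-c).
  by split; lra.
pose v i := (T i).1.1.
have p2 i : 0 < (2:R) ^+ i by exact: exprn_gt0.
have vC i j : nrm (v (i + j)%N - v i) <= 2 * r / 2 ^+ i - 2 * r / 2 ^+ (i + j).
  elim: j => [|j ih]; first by rewrite addn0 !subrr nrm0.
  apply: le_trans (nrm_triB _ (v (i + j)%N) _) _.
  rewrite addnS; have := apex_quarter (nxt (T (i + j)%N, e / 4 ^+ (i + j))) (sT (i + j)%N).
  rewrite -/(T (i + j).+1) -/(v _) -/(v _) => h.
  have : 2 * r / 2 ^+ (i + j).+1 = r / 2 ^+ (i + j).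
    by rewrite exprSr invfM; field; rewrite gt_eqF.
  by move: h ih; rewrite -!mulrA; lra.
have [p [Dp clp]] : exists p, D p /\ cluster (v @ \oo) p.
  have [|p [Dp clp]] := kD (v @ \oo) _; last by exists p.
  by exists 0%N => // i _; case: (iT i).
have vp i : nrm (v i - p) <= 2 * r / 2 ^+ i.
  apply/ler_addgt0Pr => e' e'0.
  have [] := clp [set x | nrm (x - v i) <= 2 * r / 2 ^+ i] [set x | nrm (x - p) < e'].
  - exists i => // j /= ij; rewrite -(subnKC ij).
    apply: le_trans (vC _ _) _; rewrite gerBl.
    by rewrite divr_ge0 ?mulr_ge0// ltW.
  - by apply/nbhs_nrm; exists e'.
  move=> x [/= h1 h2]; apply: le_trans (nrm_triB _ x _) _.
  by rewrite lerD ?(ltW h2)// nrmB.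
have [d Hd] := dD _ Dp.
(* the sum over T i is at most 9 e' r^2 / 4^i: three edges of length r / 2^i, on
   which the affine error is at most e' times 3 r / 2^i *)
pose e' := e / (10 * r ^+ 2).
have e'0 : 0 < e' by rewrite divr_gt0// mulr_gt0// exprn_gt0.
have [del del0 Hdel] := Hd _ e'0.
have [i Hi] : exists i, 3 * r / 2 ^+ i < del.
  have : (fun i => 3 * r / 2 ^+ i) @ \oo --> (3 * r * 0 : R).
    apply: cvgMr; under eq_fun do rewrite -exprVn.
    by apply: cvg_expr; rewrite ger0_norm ?invr_ge0// invf_lt1// ltr1n.
  rewrite mulr0 => /cvgrPdist_lt/(_ _ del0)[N _ /(_ N (leqnn N))].
  by rewrite /= sub0r normrN => h; exists N; exact: le_lt_trans (ler_norm _) h.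
have [m _] := oT i 0%N.
apply/negP; rewrite -ltNge.
set rho := 3 * r / 2 ^+ i.
have kaff x : nrm (x - p) <= rho -> nrm (k x - (k p - d * p + d * x)) <= e' * rho.
  move=> xp; rewrite (_ : _ - _ = k x - k p - d * (x - p)); last by ring.
  apply: le_trans (Hdel _ (le_lt_trans xp Hi)) _.
  by rewrite ler_pM2l.
have rho0 : 0 <= rho by rewrite /rho divr_ge0 ?mulr_ge0// ltW.
have er0 : 0 <= e' * rho by rewrite mulr_ge0// ltW.
have [s1 s2 s3] := sT i.
have tp x : nrm (x - v i) <= r / 2 ^+ i -> nrm (x - p) <= rho.
  move=> xv; apply: le_trans (nrm_triB _ (v i) _) _.
  by have := vp i; move: xv; rewrite /rho -!mulrA; lra.
have ri0 : 0 <= r / 2 ^+ i by rewrite divr_ge0// ltW.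
have := @triangle_affine k _ _ _ _ _ m _ _ _ (@ball_midconvex p rho) kaff er0
   _ _ _ s1 s2 s3.
move=> /(_ _ _ _)/le_lt_trans; apply.
- by apply: tp; rewrite subrr nrm0.
- exact: tp.
- by apply: tp; rewrite nrmB.
rewrite /rho /e'.
have -> : (4:R) ^+ i = 2 ^+ i * 2 ^+ i by rewrite -exprMn; congr (_ ^+ _); ring.
have := p2 i; move: (2 ^+ i) => q q0.
rewrite [ltLHS](_ : _ = 9 / 10 * (e / (q * q))); last by field; rewrite !gt_eqF.
have : 0 < e / (q * q) by rewrite divr_gt0// mulr_gt0.
lra.
Qed.

End Goursat.

(** * Sums over roots of unity *)
Section Circle.
Context {R : realType}.
Local Notation C := (Cplx R).
Implicit Types (a b c p : C) (k g : C -> C) (D : set C).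

Lemma closed_Re (u p : C) (tau : R) :
  closed [set x : C | tau <= complex.Re (u * (x - p))].
Proof.
rewrite [X in closed X](_ : _ =
  (fun x => complex.Re (u * (x - p))) @^-1` [set t | tau <= t])//.
apply: closed_comp; last exact: closed_ge.
move=> x _; apply: (@continuous_comp _ _ _ (fun x : C => u * (x - p))).
  apply/(@cvg_nrm R C C (fun x : C => u * (x - p)) x) => e e0.
  exists (e / (nrm u + 1)); first by rewrite divr_gt0// ltr_wpDl ?nrm_ge0.
  move=> y; rewrite ltr_pdivlMr ?ltr_wpDl ?nrm_ge0// => h.
  rewrite (_ : _ - _ = u * (y - x)); last by ring.
  by rewrite nrmM; move: h; have := nrm_ge0 (y - x); lra.
exact: Re_continuous.
Qed.

Lemma midconvex_Re (u p : C) (tau : R) :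
  midconvex [set x : C | tau <= complex.Re (u * (x - p))].
Proof.
move=> a b /=.
have -> : u * (midpoint a b - p) = rC 2^-1 * (u * (a - p) + u * (b - p)).
  by rewrite fmorphV rmorph_nat /midpoint; field.
case: (u * (a - p)) (u * (b - p)) => [x y] [z w] /=.
rewrite mul0r subr0; lra.
Qed.

Lemma Re_half a : complex.Re (a / 2) = complex.Re a / 2.
Proof.
rewrite mulrC -(rmorph_nat rC 2) -fmorphV.
by case: a => x y /=; rewrite mul0r subr0 mulrC.
Qed.

Lemma vanishesD (u v : nat -> C) :
  vanishes u -> vanishes v -> vanishes (fun m => u m + v m).
Proof.
move=> hu hv e e0; have e2 : 0 < e / 2 by rewrite divr_gt0.
have [M HM] := hu _ e2; have [N HN] := hv _ e2.
exists (maxn M N) => m; rewrite geq_max => /andP[/HM h1 /HN h2].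
by rewrite (le_lt_trans (nrmD _ _))//; lra.
Qed.

Lemma trapez_bound k D (B : R) m a b : midconvex D ->
  (forall x, D x -> nrm (k x) <= B) -> D a -> D b ->
  nrm (trapez k m a b) <= B * nrm (b - a).
Proof.
move=> cD kB Da Db.
have := @trapez_affine _ k D 0 0 B m a b cD _ Da Db.
rewrite !mul0r !addr0 !subr0; apply=> x Dx.
by rewrite mul0r addr0 subr0; exact: kB.
Qed.

(** A triangle may have an exceptional vertex [p] where [k] is only bounded: of its
four quarters, three avoid [p] (they lie in a half-plane that does not contain
[p]) and are covered by Goursat's lemma, while the quarter at [p] is half as
large.  Iterating, only an arbitrarily small triangle at [p] remains. *)
Lemma triangle_apex k D (B : R) p a b : compact D -> midconvex D -> D p ->
  (forall x, D x -> x != p -> cderivable k x) ->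
  (forall x, D x -> nrm (k x) <= B) ->
  D a -> D b -> nrm (b - a) < nrm (a - p) ->
  vanishes (fun m => triangle_sum k m p a b).
Proof.
move=> kD cD Dp dD kB Da Db ab.
have B0 : 0 <= B by apply: le_trans (kB _ Dp); exact: nrm_ge0.
have ap0 : 0 < nrm (a - p) by apply: le_lt_trans ab; exact: nrm_ge0.
pose u := (a - p)^-1; have ap : a - p != 0 by rewrite -nrm_gt0.
have ua : 0 < complex.Re (u * (a - p)) by rewrite mulVf //= ltr01.
have ub : 0 < complex.Re (u * (b - p)).
  have -> : u * (b - p) = 1 + u * (b - a) by rewrite /u; field.
  have : nrm (u * (b - a)) < 1.
    by rewrite nrmM nrmV mulrC ltr_pdivrMr// mul1r.
  have := nrm_Re (u * (b - a)); rewrite ler_norml.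
  by case: (u * (b - a)) => x y /= /andP[]; lra.
clearbody u; clear ab ap0 ap.
pose r := nrm (a - p) + nrm (b - a) + nrm (p - b).
have rE : r = nrm (a - p) + nrm (b - a) + nrm (p - b) by [].
(* after l bisections towards p, the trivial bound on the remaining triangle *)
suff H l : forall e : R, 0 < e -> exists M, forall m, (M <= m)%N ->
    nrm (triangle_sum k m p a b) < e + B * r / 2 ^+ l.
  move=> e e0.
  have [l Hl] : exists l, B * r / 2 ^+ l < e / 2.
    have e2 : 0 < e / 2 by rewrite divr_gt0.
    have : (fun i => B * r / 2 ^+ i) @ \oo --> (B * r * 0 : R).
      apply: cvgMr; under eq_fun do rewrite -exprVn.
      by apply: cvg_expr; rewrite ger0_norm ?invr_ge0// invf_lt1// ltr1n.
    rewrite mulr0 => /cvgrPdist_lt/(_ _ e2)[N _ /(_ N (leqnn N))].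
    by rewrite /= sub0r normrN => h; exists N; exact: le_lt_trans (ler_norm _) h.
  have [|M HM] := H l (e / 2); first by rewrite divr_gt0.
  by exists M => m /HM; lra.
clearbody r.
elim: l a b r rE Da Db ua ub => [|l ih] a b r rE Da Db ua ub e e0.
  exists 0%N => m _; rewrite expr0 divr1 rE.
  have h1 := @trapez_bound k D B m p a cD kB Dp Da.
  have h2 := @trapez_bound k D B m a b cD kB Da Db.
  have h3 := @trapez_bound k D B m b p cD kB Db Dp.
  rewrite /triangle_sum; apply: le_lt_trans (nrmD _ _) _.
  have := nrmD (trapez k m p a) (trapez k m a b); lra.
pose tau := Num.min (complex.Re (u * (a - p))) (complex.Re (u * (b - p))) / 2.
have tau0 : 0 < tau by rewrite divr_gt0// lt_min ua ub.
have ta : tau <= complex.Re (u * (a - p)) / 2 by rewrite ler_pM2r ?invr_gt0// ge_min lexx.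
have tb : tau <= complex.Re (u * (b - p)) / 2 by rewrite ler_pM2r ?invr_gt0// ge_min lexx orbT.
pose E := D `&` [set x : C | tau <= complex.Re (u * (x - p))].
have cE : compact E by apply: compact_closedI => //; exact: closed_Re.
have mE : midconvex E.
  by move=> x y [? ?] [? ?]; split; [exact: cD|exact: midconvex_Re].
have dE x : E x -> cderivable k x.
  move=> [Dx /= tx]; apply: dD => //; apply/eqP => xp.
  by move: tx; rewrite xp subrr mulr0 /= leNgt tau0.
have Dpa := cD _ _ Dp Da; have Dpb := cD _ _ Dp Db.
have upa : u * (midpoint p a - p) = u * (a - p) / 2 by rewrite midpointBl mulrA.
have upb : u * (midpoint p b - p) = u * (b - p) / 2 by rewrite midpointBl mulrA.
have Ea : E a by split => //=; lra.
have Eb : E b by split => //=; lra.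
have Epa : E (midpoint p a) by split => //=; rewrite upa Re_half.
have Epb : E (midpoint p b) by split => //=; rewrite upb Re_half.
have Eab := mE _ _ Ea Eb.
have v1 := goursat cE mE dE Epa Ea Eab.
have v2 := goursat cE mE dE Epb Eab Eb.
have v3 := goursat cE mE dE Epa Eab Epb.
have e2 : 0 < e / 2 by rewrite divr_gt0.
have [M HM] := vanishesD (vanishesD v1 v2) v3 e2.
have [|||||N HN] := ih (midpoint p a) (midpoint p b) (r / 2) _ _ _ _ _ (e / 2) e2 => //.
- rewrite rE (nrmB p (midpoint _ _)) !midpointBl.
  rewrite (_ : midpoint p b - midpoint p a = (b - a) / 2); last by rewrite /midpoint; field.
  by rewrite !nrm_half (nrmB p b); lra.
- by rewrite upa Re_half divr_gt0.
- by rewrite upb Re_half divr_gt0.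
exists (maxn M N).+1 => -[//|m]; rewrite ltnS geq_max => /andP[/HM h1 /HN].
have -> : B * (r / 2) / 2 ^+ l = B * r / 2 ^+ l.+1 by rewrite exprS invfM; ring.
move=> h2; rewrite triangle_split.
have assoc (x y z t : C) : x + y + z + t = x + (y + z + t) by ring.
by rewrite assoc; apply: le_lt_trans (nrmD _ _) _; move: h1 h2 => /=; lra.
Qed.

Lemma vanishes_sum N (u : nat -> nat -> C) :
  (forall j, (j < N)%N -> vanishes (u j)) -> vanishes (fun m => \sum_(j < N) u j m).
Proof.
elim: N => [|N ih] h.
  by move=> e e0; exists 0%N => m _; rewrite big_ord0 nrm0.
have := vanishesD (ih (fun j jN => h j (ltnW jN))) (h N (ltnSn N)).
by move=> H e /H[M HM]; exists M => m /HM; rewrite big_ord_recr.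
Qed.

(** Cauchy's theorem for the regular polygon inscribed in the circle: the triangles
from [p] to its sides have vanishing sums and their inner edges cancel, so the
sums along the polygon vanish too.  On one side, [k] is almost constant, which
leaves a Riemann sum.  As [z_(j+1) - z_j = (w - 1) z_j], this sum has the factor
[w - 1], which can be divided out because only the size of the sides relative
to [nrm (w - 1)] matters. *)
Lemma circle_sum k (s : R) p (B : R) :
  0 < s -> nrm p < s ->
  (forall x, nrm x <= s -> x != p -> cderivable k x) ->
  (forall x, nrm x <= s -> nrm (k x) <= B) ->
  (forall e : R, 0 < e -> exists2 d : R, 0 < d &
    forall x y, nrm x = s -> nrm (y - x) < d -> nrm (k y - k x) < e) ->
  forall e : R, 0 < e -> exists2 d : R, 0 < d & forall (w : C) N,
    w ^+ N = 1 -> nrm w = 1 -> 0 < nrm (w - 1) < d ->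
    nrm (\sum_(j < N) k (rC s * w ^+ j) * (rC s * w ^+ j)) <= e * N%:R.
Proof.
move=> s0 ps dk kB uk e e0.
have es0 : 0 < e / s by rewrite divr_gt0.
have [d d0 Hd] := uk _ es0.
exists (Num.min d (s - nrm p) / s).
  by rewrite divr_gt0// lt_min d0 subr_gt0.
move=> w N wN w1 /andP[w0]; rewrite ltr_pdivlMr// lt_min => /andP[wd wp].
pose z j : C := rC s * w ^+ j.
have zs j : nrm (z j) = s.
  by rewrite nrmM nrm_rC nrmX w1 expr1n mulr1 ger0_norm// ltW.
have zB j : z j.+1 - z j = z j * (w - 1) by rewrite /z exprSr; ring.
have zBn j : nrm (z j.+1 - z j) = nrm (w - 1) * s by rewrite zB nrmM zs mulrC.
pose D := [set x : C | nrm x <= s].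
have kD : compact D by exact: disk_compact.
have mD : midconvex D.
  have := @ball_midconvex R 0 s; rewrite /midconvex /= => H x y /= xs ys.
  by have := H x y; rewrite !subr0; apply.
have Dz j : D (z j) by rewrite /D /= zs.
have V : vanishes (fun m => \sum_(j < N) triangle_sum k m p (z j) (z j.+1)).
  apply: (vanishes_sum (u := fun j m => triangle_sum k m p (z j) (z j.+1))) => j _.
  apply: (@triangle_apex k D B) => //; first by rewrite /D /= ltW.
  rewrite zBn; apply: lt_le_trans wp _.
  by have := nrm_triB (z j) p 0; rewrite !subr0 zs; lra.
have V' : vanishes (fun m => \sum_(j < N) trapez k m (z j) (z j.+1)).
  move=> e' /V[M HM]; exists M => m /HM; congr (nrm _ < _).
  transitivity (\sum_(j < N) (trapez k m (z j) (z j.+1) -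
     (trapez k m p (z j.+1) - trapez k m p (z j)))).
    apply: eq_bigr => j _; rewrite /triangle_sum (trapez_sym k m p (z j.+1)).
    by ring.
  rewrite big_split /= [X in _ + X](_ : _ = 0) ?addr0// sumrN.
  rewrite -(big_mkord predT (fun j => trapez k m p (z j.+1) - trapez k m p (z j))).
  by rewrite telescope_sumr// /z wN expr0 subrr oppr0.
have est m j : nrm (trapez k m (z j) (z j.+1) - k (z j) * (z j.+1 - z j)) <=
    e / s * (nrm (w - 1) * s).
  have := @trapez_affine _ k [set x | nrm (x - z j) <= nrm (w - 1) * s]
     (k (z j)) 0 (e / s) m (z j) (z j.+1) (@ball_midconvex _ _ _).
  rewrite /= !mul0r !addr0 -(mulrBr (k (z j)) (z j.+1)) zBn; apply; last by [].
    move=> x xz; rewrite mul0r addr0 ltW// Hd//.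
    exact: le_lt_trans xz _.
  by rewrite (subrr (z j)) nrm0 mulr_ge0// ?nrm_ge0// ltW.
set S := \sum_(j < N) _.
have SE : (w - 1) * S = \sum_(j < N) k (z j) * (z j.+1 - z j).
  by rewrite mulr_sumr; apply: eq_bigr => j _; rewrite zB /z; ring.
rewrite -(ler_pM2l w0) -nrmM SE; apply/ler_addgt0Pr => e' e'0.
have [M /(_ M (leqnn M)) HM] := V' _ e'0.
rewrite [X in nrm X](_ : _ = \sum_(j < N) trapez k M (z j) (z j.+1) -
  \sum_(j < N) (trapez k M (z j) (z j.+1) - k (z j) * (z j.+1 - z j))); last first.
  by rewrite -sumrB; apply: eq_bigr => j _; ring.
apply: le_trans (nrmD _ _) _; rewrite nrmN addrC lerD// ?(ltW HM)//.
apply: le_trans (nrm_sum _ _ _) _.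
apply: le_trans (ler_sum _ (fun (j : 'I_N) _ => est M j)) _.
rewrite sumr_const card_ord -[leLHS]mulr_natr.
rewrite le_eqVlt; apply/orP; left; apply/eqP; field.
by rewrite gt_eqF.
Qed.

End Circle.

(** * Cauchy's formula as a limit of means *)
Section Cauchy.
Context {R : realType}.
Local Notation C := (Cplx R).
Implicit Types (a b c p l : C) (k g : C -> C) (s : R).

Definition dyadic_root m : C :=
  Complex (cos (pi *+ 2 / 2 ^+ m : R)) (sin (pi *+ 2 / 2 ^+ m)).

Lemma dyadic_root0 : dyadic_root 0 = 1.
Proof. by rewrite /dyadic_root expr0 divr1 cos2pi mulr2n sinDpi sinpi oppr0. Qed.

Lemma dyadic_root_sqr m : dyadic_root m.+1 ^+ 2 = dyadic_root m.
Proof.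
rewrite /dyadic_root; set x := _ / _.
have -> : pi *+ 2 / 2 ^+ m = x *+ 2 :> R.
  by rewrite /x exprSr invfM -mulr_natr; field; rewrite expf_neq0.
rewrite cos_mulr2n sin_mulr2n expr2; congr Complex.
  by rewrite -!expr2 sin2cos2; ring.
by ring.
Qed.

Lemma dyadic_root_expr m : dyadic_root m ^+ (2 ^ m) = 1.
Proof.
elim: m => [|m ih]; first by rewrite dyadic_root0 expr1n.
by rewrite expnS exprM dyadic_root_sqr.
Qed.

Lemma dyadic_root_half m : dyadic_root m.+1 ^+ (2 ^ m) = -1.
Proof.
elim: m => [|m ih]; last by rewrite expnS exprM dyadic_root_sqr.
rewrite expr1 /dyadic_root expr1.
have -> : pi *+ 2 / 2 = pi :> R by field.
by rewrite cospi sinpi; apply/eqP; rewrite eq_complex /= oppr0 !eqxx.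
Qed.

Lemma nrm_dyadic_root m : nrm (dyadic_root m) = 1.
Proof.
apply/eqP; rewrite -(@pexpr_eq1 _ _ (2 ^ m)) ?nrm_ge0 ?expn_gt0//.
by rewrite -nrmX dyadic_root_expr nrm1.
Qed.

Lemma dyadic_root_neq1 m : dyadic_root m.+1 != 1.
Proof.
apply/eqP => w1; have := dyadic_root_half m.
by rewrite w1 expr1n => /eqP; rewrite -addr_eq0 (@pnatr_eq0 C 2).
Qed.

Lemma dyadic_root_cvg1 (d : R) : 0 < d ->
  exists M, forall m, (M <= m)%N -> nrm (dyadic_root m - 1) < d.
Proof.
move=> d0; have d2 : 0 < d / 2 by rewrite divr_gt0.
have h : (fun m => pi *+ 2 / 2 ^+ m : R) @ \oo --> (0 : R).
  rewrite -[X in _ --> X](mulr0 (pi *+ 2)).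
  apply: cvgMr; under eq_fun do rewrite -exprVn.
  by apply: cvg_expr; rewrite ger0_norm ?invr_ge0// invf_lt1// ltr1n.
have hc : (fun m => cos (pi *+ 2 / 2 ^+ m : R)) @ \oo --> (1 : R).
  by rewrite -[X in _ --> X]cos0; apply: continuous_cvg h; exact: continuous_cos.
have hs : (fun m => sin (pi *+ 2 / 2 ^+ m : R)) @ \oo --> (0 : R).
  by rewrite -[X in _ --> X]sin0; apply: continuous_cvg h; exact: continuous_sin.
move/cvgrPdist_lt: hc => /(_ _ d2)[N1 _ H1].
move/cvgrPdist_lt: hs => /(_ _ d2)[N2 _ H2].
exists (maxn N1 N2) => m; rewrite geq_max => /andP[/H1 /= h1 /H2 /= h2].
apply: le_lt_trans (nrm_le_ReIm _) _ => /=.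
by rewrite oppr0 addr0; move: h1 h2; rewrite distrC sub0r normrN; lra.
Qed.

Lemma sum_doubled (F : nat -> C) n :
  \sum_(j < n + n) F j = \sum_(j < n) (F j + F (n + j)%N).
Proof. by rewrite big_split_ord big_split. Qed.

(** The Cauchy kernel can be summed exactly: opposite nodes [z] and [- z] together
give [2 z^2 / (z^2 - l^2)], the kernel for [s^2], [l^2] and half as many nodes. *)
Lemma sum_kernel m (s l : C) : nrm l < nrm s ->
  \sum_(j < 2 ^ m) (s * dyadic_root m ^+ j) / (s * dyadic_root m ^+ j - l) =
  (2 ^ m)%:R * (s ^+ (2 ^ m) / (s ^+ (2 ^ m) - l ^+ (2 ^ m))).
Proof.
elim: m s l => [|m ih] s l ls.
  by rewrite big_ord_recl big_ord0 addr0 expr0 mulr1 mul1r !expr1.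
rewrite expnS mul2n -addnn.
rewrite (sum_doubled (fun j => (s * dyadic_root m.+1 ^+ j) / (s * dyadic_root m.+1 ^+ j - l))).
rewrite addnn -mul2n !exprM natrM -mulrA -ih; last first.
  by rewrite !nrmX ltr_pXn2r// nnegrE nrm_ge0.
rewrite mulr_sumr; apply: eq_bigr => j _.
rewrite exprD dyadic_root_half mulN1r mulrN.
have -> : s ^+ 2 * dyadic_root m ^+ j = (s * dyadic_root m.+1 ^+ j) ^+ 2.
  by rewrite -dyadic_root_sqr -!exprM exprMn -exprM mulnC.
have : nrm (s * dyadic_root m.+1 ^+ j) = nrm s.
  by rewrite nrmM nrmX nrm_dyadic_root expr1n mulr1.
move: (s * _) => z zs.
have n1 : z - l != 0.
  by apply/eqP => /eqP; rewrite subr_eq0 => /eqP zl; move: ls; rewrite -zs zl ltxx.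
have n2 : z + l != 0.
  apply/eqP => /eqP; rewrite addr_eq0 => /eqP zl; move: ls.
  by rewrite -zs zl nrmN ltxx.
have n3 : - z - l != 0 by rewrite -opprD oppr_eq0.
have n4 : z ^+ 2 - l ^+ 2 != 0 by rewrite subr_sqr mulf_neq0.
by field; rewrite n1 n3 n4.
Qed.

Lemma cderivable_cont k p : cderivable k p -> forall e : R, 0 < e ->
  exists2 d : R, 0 < d & forall x, nrm (x - p) < d -> nrm (k x - k p) < e.
Proof.
move=> [d Hd] e e0; have [del del0 H] := Hd 1 ltr01.
have n0 : 0 < nrm d + 1 by rewrite ltr_wpDl ?nrm_ge0.
exists (Num.min del (e / (nrm d + 1))); first by rewrite lt_min del0 divr_gt0.
move=> x; rewrite lt_min ltr_pdivlMr// => /andP[/H h1 h2].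
have -> : k x - k p = (k x - k p - d * (x - p)) + d * (x - p) by ring.
apply: le_lt_trans (nrmD _ _) _; rewrite nrmM.
by move: h1 h2; lra.
Qed.

Definition slope g l d (x : C) : C := if x == l then d else (g x - g l) / (x - l).

(** The quotient rule, in the elementary form of [cderivable]. *)
Lemma slope_cderivable g l d p : p != l -> cderivable g p ->
  cderivable (slope g l d) p.
Proof.
move=> pl [g' Hg].
have pl0 : 0 < nrm (p - l) by rewrite nrm_gt0 subr_eq0.
have plN : p - l != 0 by rewrite subr_eq0.
pose ka := (g p - g l) / (p - l); pose k' := (g' - ka) / (p - l).
exists k' => e e0; set r := nrm (p - l) in pl0.
have [|del del0 Hdel] := Hg (e * r / 4); first by rewrite divr_gt0// mulr_gt0.
have n0 : 0 < nrm k' + 1 by rewrite ltr_wpDl ?nrm_ge0.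
exists (Num.min del (Num.min (r / 2) (e * r / 4 / (nrm k' + 1)))).
  by rewrite !lt_min del0 !divr_gt0// mulr_gt0.
move=> x; rewrite !lt_min => /and3P[/Hdel h1 h2].
rewrite ltr_pdivlMr// => h3.
have hx : r / 2 <= nrm (x - l).
  have := nrm_triB p x l; rewrite -/r (nrmB p x); lra.
have hxl : x - l != 0 by rewrite -nrm_gt0 (lt_le_trans _ hx)// divr_gt0.
have xl : x != l by rewrite -subr_eq0.
rewrite /slope (negbTE xl) (negbTE pl).
have -> : (g x - g l) / (x - l) - (g p - g l) / (p - l) - k' * (x - p) =
   ((g x - g p - g' * (x - p)) - k' * (x - p) * (x - p)) / (x - l).
  rewrite /k' /ka; field; by rewrite plN hxl.
rewrite nrmM nrmV ler_pdivrMr ?nrm_gt0//.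
apply: le_trans (nrmD _ _) _; rewrite nrmN (nrmM (k' * _)) (nrmM k').
have x0 := nrm_ge0 (x - p).
have A : nrm k' * nrm (x - p) * nrm (x - p) <= e * r / 4 * nrm (x - p).
  rewrite ler_wpM2r//; apply: le_trans (ltW h3).
  by rewrite mulrC ler_wpM2l// lerDl.
have B : e * nrm (x - p) * (r / 2) <= e * nrm (x - p) * nrm (x - l).
  by rewrite ler_wpM2l// mulr_ge0// ltW.
have E : e * r / 4 * nrm (x - p) = e * nrm (x - p) * (r / 2) / 2 by field.
by move: h1 A B; rewrite E; lra.
Qed.

(** The mean over the [2^m] nodes that discretizes
[(2 i pi)^-1] times the integral of [g z / (z - l)] over the circle of radius [s]. *)
Definition cauchy_mean s m g l : C :=
  (\sum_(j < 2 ^ m) g (rC s * dyadic_root m ^+ j) *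
     (rC s * dyadic_root m ^+ j / (rC s * dyadic_root m ^+ j - l))) / (2 ^ m)%:R.

Lemma nrm_node s m j : 0 < s -> nrm (rC s * dyadic_root m ^+ j) = s.
Proof.
by move=> s0; rewrite nrmM nrmX nrm_dyadic_root expr1n mulr1 nrm_rC gtr0_norm.
Qed.

Lemma nrm_mean_le n (F : nat -> C) (e : R) : (0 < n)%N ->
  nrm (\sum_(j < n) F j) <= e * n%:R -> nrm ((\sum_(j < n) F j) / n%:R) <= e.
Proof.
by move=> n0 h; rewrite nrmM nrmV nrm_nat ler_pdivrMr// ltr0n.
Qed.

(** With [k] the slope of [g] at [l], the summand is [k z * z] plus [g l] times the
kernel.  The mean of the first tends to 0 by [circle_sum], [l] being the
exceptional point; that of the kernel is [1 / (1 - x)] where [x = (l / s)^(2^m)]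
tends to 0. *)
Lemma cauchy_formula s g l : 0 < s -> nrm l < s ->
  (forall x, nrm x <= s -> cderivable g x) ->
  vanishes (fun m => cauchy_mean s m g l - g l).
Proof.
move=> s0 ls dg.
have [d Hd] := dg l (ltW ls).
pose k := slope g l d.
have kd x : nrm x <= s -> x != l -> cderivable k x.
  by move=> xs xl; apply: slope_cderivable => //; exact: dg.
have kc x : nrm x <= s -> forall e : R, 0 < e ->
    exists2 del : R, 0 < del & forall y, nrm (y - x) < del -> nrm (k y - k x) < e.
  move=> xs; have [->|xl] := eqVneq x l; last exact: (cderivable_cont (kd _ xs xl)).
  move=> e e0; have e2 : 0 < e / 2 by rewrite divr_gt0.
  have [del del0 H] := Hd _ e2; exists del => // y /H.
  rewrite /k /slope eqxx; case: eqVneq => [_ _|yl h]; first by rewrite subrr nrm0.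
  have yl0 : y - l != 0 by rewrite subr_eq0.
  have -> : (g y - g l) / (y - l) - d = (g y - g l - d * (y - l)) / (y - l) by field.
  rewrite nrmM nrmV ltr_pdivrMr ?nrm_gt0// (le_lt_trans h)//.
  by rewrite ltr_pM2r ?nrm_gt0//; lra.
have kD := @disk_compact R s.
have [B HB] : exists B : R, forall x, nrm x <= s -> nrm (k x) <= B.
  have [B HB] := @compact_image_bounded R C [set x | nrm x <= s] k kD kc.
  by exists B => x; exact: HB.
have kU : forall e : R, 0 < e -> exists2 del : R, 0 < del &
    forall x y, nrm x = s -> nrm (y - x) < del -> nrm (k y - k x) < e.
  move=> e e0; have [b b0 Hb] := @compact_uniformly_continuous R C [set x | nrm x <= s] k kD kc e e0.
  by exists b => // x y xs; apply: Hb; rewrite /= xs.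
move=> e e0; have e4 : 0 < e / 4 by rewrite divr_gt0.
have [del del0 Hdel] := circle_sum s0 ls kd HB kU e4.
have [M1 HM1] := dyadic_root_cvg1 del0.
pose q : R := nrm l / s.
have q0 : 0 <= q by rewrite divr_ge0 ?nrm_ge0// ltW.
have q1 : q < 1 by rewrite ltr_pdivrMr// mul1r.
pose G := nrm (g l) + 1.
have G0 : 0 < G by rewrite ltr_wpDl ?nrm_ge0.
have [M2 HM2] : exists M, forall m, (M <= m)%N ->
    q ^+ (2 ^ m) < (e / (e + 4 * G)).
  have eg : 0 < e / (e + 4 * G) by rewrite divr_gt0// addr_gt0// mulr_gt0.
  have : (fun m => q ^+ m) @ \oo --> (0:R) by apply: cvg_expr; rewrite ger0_norm.
  move=> /cvgrPdist_lt/(_ _ eg)[N _ HN]; exists N => m Nm.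
  have /HN /= : (N <= 2 ^ m)%N by rewrite (leq_trans Nm)// ltnW// ltn_expl.
  by rewrite sub0r normrN; exact: le_lt_trans (ler_norm _).
exists (maxn M1 M2).+1 => -[//|m]; rewrite ltnS geq_max => /andP[m1 m2].
have n0 : (0 < 2 ^ m.+1)%N by rewrite expn_gt0.
have sC : nrm (rC s) = s by rewrite nrm_rC gtr0_norm.
have hk := Hdel (dyadic_root m.+1) (2 ^ m.+1)%N (dyadic_root_expr _) (nrm_dyadic_root _).
have {hk} := hk _.
rewrite nrm_gt0 subr_eq0 dyadic_root_neq1 HM1 ?(leqW m1)// => /(_ isT).
move=> /(@nrm_mean_le _ (fun j => k (rC s * dyadic_root m.+1 ^+ j) * (rC s * dyadic_root m.+1 ^+ j)) _ n0) hk.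
have ker := @sum_kernel m.+1 (rC s) l; rewrite sC in ker; have {}ker := ker ls.
set N := (2 ^ m.+1)%N in n0 hk ker *.
pose x := (l / rC s) ^+ N.
have xn : nrm x < e / (e + 4 * G).
  by rewrite /x nrmX nrmM nrmV sC; apply: HM2; exact: leqW.
have s0' : rC s != 0 by rewrite -nrm_gt0 sC.
have x1 : nrm x < 1.
  apply: lt_le_trans xn _; rewrite ler_pdivrMr ?addr_gt0 ?mulr_gt0//.
  by rewrite mul1r lerDl mulr_ge0// ltW.
have x1' : 1 - x != 0.
  by apply/eqP => /eqP; rewrite subr_eq0 => /eqP x1'; move: x1; rewrite -x1' nrm1 ltxx.
have kerE : rC s ^+ N / (rC s ^+ N - l ^+ N) = 1 / (1 - x).
  have : rC s ^+ N != 0 by rewrite expf_neq0.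
  move: x1'; rewrite /x expr_div_n; move: (rC s ^+ N) (l ^+ N) => a b h h'.
  have -> : a - b = a * (1 - b / a) by field.
  by rewrite invfM mulrA divff.
have NC0 : (N%:R : C) != 0 by rewrite pnatr_eq0 -lt0n.
have -> : cauchy_mean s m.+1 g l - g l =
   (\sum_(j < N) k (rC s * dyadic_root m.+1 ^+ j) * (rC s * dyadic_root m.+1 ^+ j)) / N%:R
   + g l * (x / (1 - x)).
  rewrite /cauchy_mean -/N.
  have -> : \sum_(j < N) g (rC s * dyadic_root m.+1 ^+ j) *
     (rC s * dyadic_root m.+1 ^+ j / (rC s * dyadic_root m.+1 ^+ j - l)) =
     \sum_(j < N) (k (rC s * dyadic_root m.+1 ^+ j) * (rC s * dyadic_root m.+1 ^+ j)
      + g l * (rC s * dyadic_root m.+1 ^+ j / (rC s * dyadic_root m.+1 ^+ j - l))).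
    apply: eq_bigr => j _.
    have := @nrm_node s m.+1 j s0; move: (rC s * _) => z zs.
    have zl : z != l by apply/eqP => zl; move: ls; rewrite -zl zs ltxx.
    have zl0 : z - l != 0 by rewrite subr_eq0.
    by rewrite /k /slope (negbTE zl); field.
  by rewrite big_split /= -mulr_sumr ker kerE; field; rewrite x1' NC0.
apply: le_lt_trans (nrmD _ _) _.
suff : nrm (g l * (x / (1 - x))) <= e / 4 by lra.
have hG : nrm (g l) <= G by rewrite /G lerDl.
have h1x : 1 - nrm x <= nrm (1 - x).
  by have := @nrm_triB R C 1 x 0; rewrite !subr0 nrm1; lra.
have h1x0 : 0 < nrm (1 - x) by rewrite nrm_gt0.
rewrite !nrmM nrmV mulrA ler_pdivrMr//.
have xn0 := nrm_ge0 x.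
move: xn; rewrite ltr_pdivlMr ?addr_gt0 ?mulr_gt0// => xn.
have A := ler_wpM2r xn0 hG.
have B' := ler_wpM2l (ltW e4) h1x.
by move: A B' xn; lra.
Qed.

End Cauchy.

(** * The remainder of order two *)
Section Taylor.
Context {R : realType}.
Local Notation C := (Cplx R).

(** The kernel minus its expansion of order one is [l^2 / (z (z - l))]. *)
Lemma cauchy_mean_taylor (s B : R) (g : C -> C) m (l : C) : 0 < s ->
  nrm l <= s / 2 -> (forall x, nrm x = s -> nrm (g x) <= B) ->
  nrm (cauchy_mean s m g l - cauchy_mean s m g 0 - l *
    ((\sum_(j < 2 ^ m) g (rC s * dyadic_root m ^+ j) / (rC s * dyadic_root m ^+ j))
       / (2 ^ m)%:R)) <= 2 * B / s ^+ 2 * nrm l ^+ 2.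
Proof.
move=> s0 ls gB; have n0 : (0 < 2 ^ m)%N by rewrite expn_gt0.
have NC0 : ((2 ^ m)%:R : C) != 0 by rewrite pnatr_eq0 -lt0n.
pose z j := rC s * dyadic_root m ^+ j.
have zs j : nrm (z j) = s by exact: nrm_node.
have z0 j : z j != 0 by rewrite -nrm_gt0 zs.
have zl j : s / 2 <= nrm (z j - l).
  by have := nrm_triB (z j) l 0; rewrite !subr0 zs; lra.
have zl0 j : z j - l != 0 by rewrite -nrm_gt0 (lt_le_trans _ (zl j))// divr_gt0.
rewrite /cauchy_mean -/(z _).
rewrite [X in nrm X](_ : _ =
   (\sum_(j < 2 ^ m) (g (z j) * (l ^+ 2 / (z j * (z j - l))))) / (2 ^ m)%:R); last first.
  rewrite mulrA -!mulrBl mulr_sumr -!sumrB; congr (_ / _).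
  by apply: eq_bigr => j _; rewrite -/(z j) subr0; field; rewrite z0 zl0.
apply: (nrm_mean_le (F := fun j => g (z j) * (l ^+ 2 / (z j * (z j - l))))) => //.
apply: le_trans (nrm_sum _ _ _) _.
rewrite mulr_natr -[X in _ *+ X]card_ord -sumr_const; apply: ler_sum => j _.
rewrite (nrmM (g _)) (nrmM (l ^+ 2)) nrmV (nrmM (z j)) nrmX zs.
have B0 : 0 <= B by apply: le_trans (gB _ (zs j)); exact: nrm_ge0.
have l0 : 0 <= nrm l ^+ 2 by rewrite exprn_ge0// nrm_ge0.
rewrite mulrA ler_pdivrMr; last by rewrite mulr_gt0// nrm_gt0.
have -> : 2 * B / s ^+ 2 * nrm l ^+ 2 * (s * nrm (z j - l)) =
  B * nrm l ^+ 2 * (nrm (z j - l) / (s / 2)) by field; rewrite gt_eqF.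
have h1 : 1 <= nrm (z j - l) / (s / 2) by rewrite ler_pdivlMr ?mul1r// divr_gt0.
apply: le_trans (ler_wpM2r l0 (gB _ (zs j))) _.
by rewrite ler_peMr// mulr_ge0.
Qed.

(** By [cauchy_mean_taylor] the coefficient [c m] satisfies the estimate up to an
error that vanishes with [m].  Using it at [l] and at [t l] for a small real [t]
eliminates [c m] and brings in the slope of [g] at [t l], which is close to [d]. *)
Lemma taylor2 (s B : R) (g : C -> C) (d l : C) : 0 < s ->
  (forall x, nrm x <= s -> cderivable g x) ->
  (forall x, nrm x = s -> nrm (g x) <= B) ->
  (forall e : R, 0 < e -> exists2 del : R, 0 < del & forall x, nrm x < del ->
    nrm (g x - g 0 - d * x) <= e * nrm x) ->
  nrm l <= s / 2 ->
  nrm (g l - g 0 - d * l) <= 2 * B / s ^+ 2 * nrm l ^+ 2.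
Proof.
move=> s0 dg gB Hd ls.
pose c m := (\sum_(j < 2 ^ m) g (rC s * dyadic_root m ^+ j) / (rC s * dyadic_root m ^+ j))
       / (2 ^ m)%:R.
pose K := 2 * B / s ^+ 2.
have K0 : 0 <= K.
  rewrite /K divr_ge0 ?exprn_ge0 ?(ltW s0)// mulr_ge0//.
  by apply: le_trans (gB (rC s) _); rewrite ?nrm_ge0// nrm_rC gtr0_norm.
have approx x : nrm x <= s / 2 -> forall e : R, 0 < e -> exists M, forall m, (M <= m)%N ->
    nrm (g x - g 0 - x * c m) < K * nrm x ^+ 2 + e.
  move=> xs e e0; have e2 : 0 < e / 2 by rewrite divr_gt0.
  have xs' : nrm x < s by rewrite (le_lt_trans xs)//; lra.
  have zs' : nrm (0 : C) < s by rewrite nrm0.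
  have [M1 H1] := cauchy_formula s0 xs' dg e2.
  have [M2 H2] := cauchy_formula s0 zs' dg e2.
  exists (maxn M1 M2) => m; rewrite geq_max => /andP[/H1 h1 /H2 h2].
  have h3 := cauchy_mean_taylor m s0 xs gB; rewrite -/(c m) -/K in h3.
  have -> : g x - g 0 - x * c m =
    (cauchy_mean s m g x - cauchy_mean s m g 0 - x * c m) +
    ((cauchy_mean s m g 0 - g 0) - (cauchy_mean s m g x - g x)) by ring.
  apply: le_lt_trans (nrmD _ _) _.
  have := nrmD (cauchy_mean s m g 0 - g 0) (- (cauchy_mean s m g x - g x)).
  by rewrite nrmN; lra.
apply/ler_addgt0Pr => e e0; rewrite -/K.
pose n1 := nrm l + 1.
have n10 : 0 < n1 by rewrite ltr_wpDl ?nrm_ge0.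
have [|del del0 Hdel] := Hd (e / (4 * n1)); first by rewrite divr_gt0// mulr_gt0.
pose q := K * nrm l ^+ 2.
have q0 : 0 <= q by rewrite mulr_ge0// exprn_ge0// nrm_ge0.
pose t := Num.min 1 (Num.min (del / (2 * n1)) (e / (4 * (q + 1)))).
have q10 : 0 < q + 1 by rewrite ltr_wpDl.
have t0 : 0 < t by rewrite !lt_min ltr01 !divr_gt0// mulr_gt0.
have t1 : t <= 1 by rewrite ge_min lexx.
have t2 : t * n1 <= del / 2.
  have : t <= del / (2 * n1) by rewrite !ge_min lexx !orbT.
  by rewrite ler_pdivlMr ?mulr_gt0//; lra.
have t3 : t * q <= e / 4.
  have : t <= e / (4 * (q + 1)) by rewrite !ge_min lexx !orbT.
  rewrite ler_pdivlMr ?mulr_gt0//; lra.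
pose eta := t * (e / 8).
have eta0 : 0 < eta by rewrite mulr_gt0// divr_gt0.
have nt : nrm (rC t * l) = t * nrm l by rewrite nrmM nrm_rC gtr0_norm.
have tl : nrm (rC t * l) <= s / 2.
  by rewrite nt; apply: le_trans ls; rewrite ler_piMl// nrm_ge0.
have [M1 H1] := approx _ ls _ eta0.
have [M2 H2] := approx _ tl _ eta0.
have h1 := H1 _ (leq_maxl M1 M2); have h2 := H2 _ (leq_maxr M1 M2).
move: (c _) h1 h2 => cm h1 h2.
have h3 : nrm (g (rC t * l) - g 0 - d * (rC t * l)) <= t * (e / 4).
  have -> : t * (e / 4) = e / (4 * n1) * (t * n1) by field; rewrite gt_eqF.
  apply: le_trans (Hdel _ _) _.
    by rewrite nt; move: t2; rewrite /n1; have := nrm_ge0 l; lra.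
  by rewrite nt ler_wpM2l ?divr_ge0 ?mulr_ge0 ?(ltW n10) ?(ltW e0)// ler_wpM2l ?ltW// /n1; lra.
rewrite -/q in h1 *; rewrite nt exprMn in h2.
have h2' : nrm (g (rC t * l) - g 0 - rC t * l * cm) < t * (e / 4) + t * (e / 8).
  apply: lt_le_trans h2 _; rewrite -/eta lerD2r.
  have -> : K * (t ^+ 2 * nrm l ^+ 2) = t * (t * q) by rewrite /q; ring.
  by rewrite ler_wpM2l// ltW.
have tn0 : rC t != 0 by rewrite -nrm_gt0 nrm_rC gtr0_norm.
have -> : g l - g 0 - d * l = (g l - g 0 - l * cm) +
   ((g (rC t * l) - g 0 - d * (rC t * l)) - (g (rC t * l) - g 0 - rC t * l * cm)) / rC t.
  by field.
apply: le_trans (nrmD _ _) _.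
set X := (Y in _ + Y <= _).
suff : X <= e / 4 + (e / 4 + e / 8).
  have : eta <= e / 8 by rewrite ler_piMl// divr_ge0// ltW.
  by move: h1; lra.
rewrite /X nrmM nrmV nrm_rC gtr0_norm// ler_pdivrMr//.
apply: le_trans (nrmD _ _) _; rewrite nrmN.
by move: h3 h2'; lra.
Qed.

End Taylor.

(** * Limits of holomorphic functions of several variables *)
Section Frechet.
Context {R : realType} {n : nat}.
Local Notation C := (Cplx R).
Implicit Types (f : 'rV[C]_n -> C) (z h : 'rV[C]_n) (c : 'I_n -> C).

(** The linear form with coefficients [c]: a complex differential is encoded by its
partial derivatives, so that limits of differentials are limits of scalars. *)
Definition lincomb c h : C := \sum_i h ord0 i * c i.

Lemma lincomb_linear c : linear (lincomb c).
Proof.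
move=> a x y; rewrite /lincomb scaler_sumr -big_split /=.
by apply: eq_bigr => i _; rewrite !mxE mulrDl -mulrA.
Qed.

HB.instance Definition _ c := GRing.isLinear.Build C 'rV[C]_n C _ (lincomb c)
  (lincomb_linear c).

Lemma nrm_lincomb c h : nrm (lincomb c h) <= (\sum_i nrm (c i)) * nrm h.
Proof.
apply: le_trans (nrm_sum _ _ _) _; rewrite mulr_suml; apply: ler_sum => i _.
by rewrite nrmM mulrC ler_wpM2l ?nrm_ge0// nrm_coord.
Qed.

Definition frechet f z c := forall e : R, 0 < e -> exists2 d : R, 0 < d &
  forall h, nrm h < d -> nrm (f (z + h) - f z - lincomb c h) <= e * nrm h.

Lemma differentiable_frechet f z :
  differentiable f z -> frechet f z (fun i => 'd f z (delta_mx ord0 i)).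
Proof.
move=> /diff_locallyP[_ /eqaddoP H] e e0.
have e0' : 0 < rC e by rewrite -(rmorph0 rC) ltr_rC.
have /nbhs_nrm[d d0 Hd] := H _ e0'.
exists d => // h hd; rewrite -ler_rC rmorphM /= -!normE.
have := Hd h; rewrite subr0 => /(_ hd).
rewrite !fctE /= (addrC h) opprD addrA.
suff -> : lincomb (fun i => 'd f z (delta_mx ord0 i)) h = 'd f z h by [].
rewrite [in RHS](row_sum_delta h) linear_sum; apply: eq_bigr => i _.
by rewrite linearZ.
Qed.

Lemma frechet_differentiable f z c : frechet f z c -> differentiable f z.
Proof.
move=> H.
have cc : continuous (lincomb c).
  move=> x; apply/(cvg_nrm (lincomb c)) => e e0.
  pose K := \sum_i nrm (c i) + 1.
  have K0 : 0 < K by rewrite ltr_wpDl// sumr_ge0// => i _; exact: nrm_ge0.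
  exists (e / K); first by rewrite divr_gt0.
  move=> y; rewrite ltr_pdivlMr// => h; rewrite -linearB.
  apply: le_lt_trans (nrm_lincomb _ _) _; apply: le_lt_trans h.
  by rewrite mulrC ler_wpM2l ?nrm_ge0// lerDl.
have lo : f \o shift z = cst (f z) + lincomb c +o_ (0 : 'rV[C]_n) id.
  apply/eqaddoP => e /rC_gt0[-> e0].
  have [d d0 Hd] := H _ e0.
  apply/nbhs_nrm; exists d => // h; rewrite subr0 => /Hd.
  by rewrite -ler_rC rmorphM /= -!normE !fctE /= (addrC h) opprD addrA.
have dE := diff_unique cc lo.
by apply/diff_locallyP; rewrite dE.
Qed.

Lemma frechet_line f z c h l : frechet f (z + l *: h) c ->
  forall e : R, 0 < e -> exists2 d : R, 0 < d & forall x, nrm (x - l) < d ->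
    nrm (f (z + x *: h) - f (z + l *: h) - lincomb c h * (x - l)) <= e * nrm (x - l).
Proof.
move=> H e e0; pose n1 := nrm h + 1.
have n10 : 0 < n1 by rewrite ltr_wpDl ?nrm_ge0.
have [|d d0 Hd] := H (e / n1); first by rewrite divr_gt0.
exists (d / n1); first by rewrite divr_gt0.
move=> x; rewrite ltr_pdivlMr// => xl.
have x0 := nrm_ge0 (x - l).
have E : z + l *: h + (x - l) *: h = z + x *: h by rewrite -addrA scalerBl subrKC.
have := Hd ((x - l) *: h); rewrite E linearZ /=.
rewrite [_ *: lincomb _ _]mulrC nrmZ.
have hh : nrm (x - l) * nrm h <= nrm (x - l) * n1 by rewrite ler_wpM2l// lerDl.
move=> /(_ (le_lt_trans hh xl))/le_trans; apply.
rewrite [leRHS](_ : _ = e / n1 * (nrm (x - l) * n1)); last by field; rewrite gt_eqF.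
by rewrite ler_wpM2l// divr_ge0// ltW.
Qed.

(** The estimate [taylor2] on the complex line from [z] to [z + h]; the parameter [1]
is well inside the disk of radius [s = rho / (2 nrm h)]. *)
Lemma frechet_taylor f z c (rho B : R) h : 0 < rho ->
  (forall w, nrm (w - z) < rho -> differentiable f w) ->
  (forall w, nrm (w - z) < rho -> nrm (f w) <= B) ->
  frechet f z c -> nrm h <= rho / 4 ->
  nrm (f (z + h) - f z - lincomb c h) <= 8 * B / rho ^+ 2 * nrm h ^+ 2.
Proof.
move=> rho0 df fB fc hr.
have [->|h0] := eqVneq h 0.
  by rewrite addr0 subrr sub0r linear0 oppr0 !nrm0 expr0n /= mulr0.
have nh : 0 < nrm h by rewrite nrm_gt0.
pose s := rho / (2 * nrm h).
have s0 : 0 < s by rewrite divr_gt0// mulr_gt0.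
have sh (x : C) : nrm x <= s -> nrm (z + x *: h - z) < rho.
  rewrite addrC addKr nrmZ => xs; apply: le_lt_trans (ler_wpM2r (ltW nh) xs) _.
  rewrite /s (_ : rho / _ * _ = rho / 2); last by field; rewrite gt_eqF.
  lra.
pose g (x : C) := f (z + x *: h).
have := @taylor2 R s B g (lincomb c h) 1 s0.
rewrite /g scale1r scale0r addr0 mulr1 nrm1 expr1n mulr1.
have -> : 8 * B / rho ^+ 2 * nrm h ^+ 2 = 2 * B / s ^+ 2.
  by rewrite /s; field; rewrite !gt_eqF.
apply.
- move=> x /sh /df /differentiable_frechet H.
  by exists (lincomb (fun i => 'd f (z + x *: h) (delta_mx ord0 i)) h); exact: frechet_line.
- by move=> x xs; apply: fB; apply: sh; rewrite xs.
- have := @frechet_line f z c h 0; rewrite scale0r addr0 => /(_ fc) H e e0.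
  by have [d d0 Hd] := H e e0; exists d => // x; rewrite -[x in nrm x < _]subr0 => /Hd; rewrite !subr0.
- by rewrite /s ler_pdivlMr// ler_pdivlMr ?mulr_gt0//; lra.
Qed.

Lemma cvg_nrm_le {T : Type} (F : set_system T) (u : T -> C) (l : C) (r : R) :
  ProperFilter F -> u @ F --> l -> (forall t, nrm (u t) <= r) -> nrm l <= r.
Proof.
move=> FF ul ur; apply/ler_addgt0Pr => e e0.
have Fe : F (u @^-1` [set x | nrm (x - l) < e]).
  by apply: ul; apply/nbhs_nrm; exists e.
have [t /= te] := filter_ex Fe.
by have := nrm_triB l (u t) 0; have := ur t; rewrite !subr0 nrmB; lra.
Qed.

Lemma fmap_ultrafilter {S T : Type} (u : S -> T) (U : set_system S) :
  UltraFilter U -> UltraFilter (u @ U).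
Proof.
move=> UU; split=> [|G GG UG]; first exact: fmap_proper_filter.
apply/seteqP; split=> // A GA.
have [//|UnA] := in_ultra_setVsetC (u @^-1` A) UU.
have GnA : G (~` A) by apply: UG.
by have [x []] := filter_ex (filterI GA GnA).
Qed.

Lemma ultra_cvg_bounded {T : Type} (U : set_system T) (u : T -> C) (r : R) :
  UltraFilter U -> (forall t, nrm (u t) <= r) -> exists l : C, u @ U --> l.
Proof.
move=> UU ur; have := @disk_compact R r; rewrite compact_ultra => H.
have Ur : (u @ U) [set x | nrm x <= r] by apply: (@filterE _ U) => t; exact: ur.
by have [l [_ ?]] := H (u @ U) (fmap_ultrafilter u UU) Ur; exists l.
Qed.

(** The Taylor estimate is uniform in [m].  It bounds the partial derivatives at [z],
which thus have limits along [U], and it passes to the limit, where it says that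
these limits are the partial derivatives of [G]. *)
Lemma ultralimit_differentiable (U : set_system nat) (F : nat -> 'rV[C]_n -> C)
    (G : 'rV[C]_n -> C) z (rho B : R) : UltraFilter U -> 0 < rho ->
  (forall m w, nrm (w - z) < rho -> differentiable (F m) w) ->
  (forall m w, nrm (w - z) < rho -> nrm (F m w) <= B) ->
  (forall w, nrm (w - z) < rho -> F m w @[m --> U] --> G w) ->
  differentiable G z.
Proof.
move=> UU rho0 dF FB FG.
pose c m i := 'd (F m) z (delta_mx ord0 i).
have zz : nrm (z - z) < rho by rewrite subrr nrm0.
have fc m : frechet (F m) z (c m) by apply: differentiable_frechet; exact: dF.
have tay m h : nrm h <= rho / 4 ->
    nrm (F m (z + h) - F m z - lincomb (c m) h) <= 8 * B / rho ^+ 2 * nrm h ^+ 2.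
  by move=> hr; apply: frechet_taylor => //; [exact: dF|exact: FB].
have B0 : 0 <= B by apply: le_trans (FB 0%N z zz); exact: nrm_ge0.
have r4 : 0 < rho / 4 by rewrite divr_gt0.
have P0 : 0 <= 8 * B / rho ^+ 2.
  by apply: divr_ge0; [exact: mulr_ge0|exact/exprn_ge0/ltW].
pose K := (8 * B / rho ^+ 2 * (rho / 4) ^+ 2 + 2 * B) / (rho / 4).
have cK i m : nrm (c m i) <= K.
  pose h : 'rV[C]_n := rC (rho / 4) *: delta_mx ord0 i.
  have hn : nrm h <= rho / 4.
    rewrite nrmZ nrm_rC gtr0_norm//; apply: ler_piMr; first exact: ltW.
    exact: nrm_delta_le1.
  have hz : nrm (z + h - z) < rho by rewrite addrC addKr; lra.
  have lE : lincomb (c m) h = rC (rho / 4) * c m i.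
    rewrite linearZ /=; congr (_ * _).
    rewrite /lincomb (bigD1 i)//= mxE !eqxx mul1r big1 ?addr0// => j ji.
    by rewrite mxE /= (negbTE ji) mul0r.
  rewrite /K ler_pdivlMr// mulrC -{1}(gtr0_norm r4) -nrm_rC -nrmM -lE.
  have -> : lincomb (c m) h = (F m (z + h) - F m z) - (F m (z + h) - F m z - lincomb (c m) h) by ring.
  apply: le_trans (nrmD _ _) _; rewrite nrmN.
  have := nrmD (F m (z + h)) (- F m z); rewrite nrmN.
  have := FB m _ hz; have := FB m _ zz.
  have h2 : nrm h ^+ 2 <= (rho / 4) ^+ 2 by rewrite lerXn2r ?nnegrE ?nrm_ge0// ltW.
  have := ler_wpM2l P0 h2; have := tay m _ hn; lra.
have /choice[cl Hcl] : forall i, exists l : C, c m i @[m --> U] --> l.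
  by move=> i; apply: (ultra_cvg_bounded (r := K)) => m; exact: cK.
have lim h : nrm h <= rho / 4 ->
    nrm (G (z + h) - G z - lincomb cl h) <= 8 * B / rho ^+ 2 * nrm h ^+ 2.
  move=> hr; have hz : nrm (z + h - z) < rho by rewrite addrC addKr; lra.
  apply: (@cvg_nrm_le _ U (fun m => F m (z + h) - F m z - lincomb (c m) h)).
    apply: cvgB; first by apply: cvgB; exact: FG.
    apply: cvg_big => [|i _]; first exact: add_continuous.
    by apply: cvgMr; exact: Hcl.
  by move=> m; exact: tay.
apply: (@frechet_differentiable _ _ cl) => e e0.
pose Q := 8 * B / rho ^+ 2 + 1.
have Q0 : 0 < Q by rewrite ltr_wpDl.
exists (Num.min (rho / 4) (e / Q)); first by rewrite lt_min r4 divr_gt0.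
move=> h; rewrite lt_min => /andP[h1]; rewrite ltr_pdivlMr// => h2.
apply: le_trans (lim _ (ltW h1)) _.
rewrite [leLHS](_ : _ = 8 * B / rho ^+ 2 * nrm h * nrm h); last by ring.
apply: ler_wpM2r; first exact: nrm_ge0.
apply: le_trans (ltW h2); rewrite [leRHS]mulrC.
by apply: ler_wpM2r; rewrite ?nrm_ge0// lerDl.
Qed.

End Frechet.

(** * Extension across a maximum of the paraboloid *)
Section Hartogs.
Context {R : realType} {n : nat}.
Local Notation C := (Cplx R).
Implicit Types (x y z q h : 'rV[C]_n) (f : 'rV[C]_n -> C).

Variables (i0 i1 : 'I_n) (i01 : i0 != i1).

(** A plurisubharmonic function with Levi form [|dz_1|^2]: it is strictly so along
the complex tangent directions of its level sets that have a component along [i1]. *)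
Definition paraboloid x : R := complex.Re (x ord0 i0) + nrm (x ord0 i1) ^+ 2.

Variable q : 'rV[C]_n.

(** The complex tangent direction at [q] to the level set of [paraboloid], normalized
to have coordinate 1 along [i1]. *)
Definition levi_dir : 'rV[C]_n := delta_mx ord0 i1 -
  (2 * Complex (complex.Re (q ord0 i1)) (- complex.Im (q ord0 i1)) : C)
    *: delta_mx ord0 i0.

(** Every point is [q + axial x *: levi_dir + transverse x], where the last vector
has coordinate 0 along [i1]. *)
Definition axial x : C := x ord0 i1 - q ord0 i1.

Definition transverse_part h : 'rV[C]_n := h - h ord0 i1 *: levi_dir.

Lemma transverse_part_linear : linear transverse_part.
Proof.
move=> a x y; rewrite /transverse_part; move: levi_dir => v.
by rewrite !mxE scalerBr scalerA scalerDl opprD addrACA.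
Qed.

HB.instance Definition _ := GRing.isLinear.Build C 'rV[C]_n 'rV[C]_n _
  transverse_part transverse_part_linear.

Definition transverse x := transverse_part (x - q).

Lemma levi_dir1 : levi_dir ord0 i1 = 1.
Proof. by rewrite !mxE !eqxx (negbTE (_ : i1 != i0)) 1?eq_sym//= mulr0 subr0. Qed.

Lemma transverse1 x : transverse x ord0 i1 = 0.
Proof.
rewrite /transverse /transverse_part; have := levi_dir1.
by move: levi_dir (x - q) => v h v1; rewrite !mxE v1 mulr1 subrr.
Qed.

Lemma splitE x : x = q + axial x *: levi_dir + transverse x.
Proof.
rewrite /transverse /transverse_part /axial; move: levi_dir => v.
by rewrite !mxE -addrA (addrC (_ *: v)) subrK addrC subrK.
Qed.

Lemma transverse_levi (t : C) h : h ord0 i1 = 0 ->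
  transverse (q + t *: levi_dir + h) = h.
Proof.
move=> h1; rewrite /transverse /transverse_part.
have -> : q + t *: levi_dir + h - q = t *: levi_dir + h.
  by apply/eqP; rewrite subr_eq [eqbRHS]addrC addrA.
have := levi_dir1; move: levi_dir => v v1.
by rewrite !mxE h1 v1 mulr1 addr0 addrC addKr.
Qed.

Lemma axial_levi (t : C) h : h ord0 i1 = 0 -> axial (q + t *: levi_dir + h) = t.
Proof.
move=> h1; rewrite /axial; have := levi_dir1; move: levi_dir => v v1.
by rewrite !mxE h1 v1; ring.
Qed.

(** Tangency removes the linear term in the direction [levi_dir], and what remains is
the Levi form. *)
Lemma paraboloidE x : paraboloid x - paraboloid q = complex.Re (transverse x ord0 i0) + nrm (axial x) ^+ 2.
Proof.
rewrite /paraboloid !nrm_sqr /transverse /transverse_part /axial !mxE !eqxx.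
rewrite (negbTE i01) /= sub0r mulr1.
case: (x ord0 i0) (q ord0 i0) (x ord0 i1) (q ord0 i1) => [a b] [c d] [s t] [u v].
by rewrite -(rmorph_nat rC 2) /=; ring.
Qed.

Lemma axial_continuous : continuous axial.
Proof.
apply: (@nrm_lipschitz_continuous R _ _ _ 1) => x y; rewrite mul1r.
have -> : axial y - axial x = (y - x) ord0 i1 by rewrite /axial !mxE; ring.
exact: nrm_coord.
Qed.

Lemma transverse_lipschitz x y :
  nrm (transverse y - transverse x) <= (1 + nrm levi_dir) * nrm (y - x).
Proof.
rewrite /transverse -linearB opprB addrA subrK /= /transverse_part.
apply: le_trans (nrmD _ _) _; rewrite nrmN nrmZ mulrDl mul1r lerD2l.
by rewrite mulrC ler_wpM2l ?nrm_ge0// nrm_coord.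
Qed.

Lemma transverse_continuous : continuous transverse.
Proof. exact: nrm_lipschitz_continuous transverse_lipschitz. Qed.

Lemma axial_affine x y (t : C) :
  axial (x + t *: (y - x)) = axial x + t * (axial y - axial x).
Proof. by rewrite /axial !mxE; ring. Qed.

Lemma transverse_affine x y (t : C) :
  transverse (x + t *: (y - x)) = transverse x + t *: (transverse y - transverse x).
Proof.
have E z : transverse z = z - q - axial z *: levi_dir.
  by rewrite /transverse /transverse_part !mxE.
rewrite !E axial_affine; move: (axial x) (axial y) levi_dir => a b v.
have -> : y - q - b *: v - (x - q - a *: v) = y - x - (b - a) *: v.
  rewrite scalerBl; move: (a *: v) (b *: v) => {}a {}b.
  rewrite (opprB (x - q)) (addrC a) addrACA (opprB x) (addrA (y - q)) subrK.
  by rewrite (opprB b) (addrC (- b)).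
rewrite (scalerBr t (y - x)) scalerA scalerDl opprD (addrAC x).
exact: addrACA.
Qed.

Lemma transverse_part_continuous : continuous transverse_part.
Proof.
apply: (@nrm_lipschitz_continuous R _ _ _ (1 + nrm levi_dir)) => x y.
have := transverse_lipschitz (x + q) (y + q).
have -> : y + q - (x + q) = y - x by apply/eqP; rewrite subr_eq addrA subrK.
by rewrite /transverse !addrK.
Qed.

Lemma transverse_differentiable x : differentiable transverse x.
Proof.
have -> : transverse = transverse_part \+ cst (- transverse_part q).
  by apply/funext => y; rewrite /= /transverse linearB.
apply: differentiableD; last exact: differentiable_cst.
exact: linear_differentiable transverse_part_continuous.
Qed.

Lemma axial_differentiable x : differentiable axial x.
Proof.
apply: differentiableB; last exact: differentiable_cst.
exact: differentiable_coord.
Qed.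

(** The discretized Cauchy integral of [f] over the circle of radius [s], in the line
through [z] of direction [levi_dir], centred where [axial] vanishes. *)
Definition disc_mean (s : R) f m z : C :=
  cauchy_mean s m (fun t => f (q + t *: levi_dir + transverse z)) (axial z).

Lemma disc_mean_differentiable (s : R) f m z : 0 < s -> nrm (axial z) < s ->
  (forall t : C, nrm t = s -> differentiable f (q + t *: levi_dir + transverse z)) ->
  differentiable (disc_mean s f m) z.
Proof.
move=> s0 zs df.
pose t j : C := rC s * dyadic_root m ^+ j.
have tz j : t j - axial z != 0.
  have ts : nrm (t j) = s by exact: nrm_node.
  by apply/eqP => /eqP; rewrite subr_eq0 => /eqP tz; move: zs; rewrite -tz ts ltxx.
pose T (j : 'I_(2 ^ m)) := (fun x : 'rV[C]_n => f (q + t j *: levi_dir + transverse x)) *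
  ((fun=> t j) * (fun x : 'rV[C]_n => (t j - axial x)^-1)) : 'rV[C]_n -> C.
have -> : disc_mean s f m = (\sum_j T j) * (fun=> (2 ^ m)%:R^-1).
  apply/funext => x; rewrite /disc_mean /cauchy_mean [RHS]/= fct_sumE.
  by congr (_ / _); apply: eq_bigr => j _.
apply: differentiableM; last exact: differentiable_cst.
apply: differentiable_sum => j; apply: differentiableM.
  apply: (@differentiable_comp _ _ _ _ (fun x => q + t j *: levi_dir + transverse x) f).
    apply: differentiableD; first exact: differentiable_cst.
    exact: transverse_differentiable.
  by apply: df; exact: nrm_node.
apply: differentiableM; first exact: differentiable_cst.
have dt : differentiable (fun x => t j - axial x) z.
  apply: differentiableB; first exact: differentiable_cst.
  exact: axial_differentiable.
exact: differentiableV dt (tz j).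
Qed.

Lemma disc_mean_bound (s B : R) f m z : 0 < s -> nrm (axial z) < s / 2 ->
  (forall t : C, nrm t = s -> nrm (f (q + t *: levi_dir + transverse z)) <= B) ->
  nrm (disc_mean s f m z) <= 2 * B.
Proof.
move=> s0 zs fB; rewrite /disc_mean /cauchy_mean.
pose t j : C := rC s * dyadic_root m ^+ j.
have ts j : nrm (t j) = s by exact: nrm_node.
apply: (nrm_mean_le (F := fun j => f (q + t j *: levi_dir + transverse z) *
  (t j / (t j - axial z)))); first by rewrite expn_gt0.
apply: le_trans (nrm_sum _ _ _) _.
rewrite mulr_natr -[X in _ *+ X]card_ord -sumr_const; apply: ler_sum => j _.
rewrite nrmM nrmM nrmV ts mulrC.
have B0 : 0 <= B by apply: le_trans (fB _ (ts j)); exact: nrm_ge0.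
apply: ler_pM; rewrite ?nrm_ge0// ?fB//.
  by rewrite divr_ge0 ?nrm_ge0// ltW.
have h : s / 2 <= nrm (t j - axial z).
  by have := nrm_triB (t j) (axial z) 0; rewrite !subr0 ts; lra.
have h0 : 0 < nrm (t j - axial z) by apply: lt_le_trans h; rewrite divr_gt0.
by rewrite ler_pdivrMr//; lra.
Qed.

(** For [z] in [U2], the circle [nrm (axial x) = s] of the line through [z] lies in
[Omega], since [s ^+ 2] wins over the transverse part in [paraboloidE]; hence a
limit of the means is holomorphic on [U2].  For [z] in [U1] the whole disk lies in
[Omega], so the limit is [f z] by Cauchy's formula. *)
Lemma hartogs_extension (Omega : set 'rV[C]_n) (rho : R) :
  0 < rho -> ~ Omega q ->
  (forall x, nrm (x - q) < rho -> paraboloid q < paraboloid x -> Omega x) ->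
  ~ domain_of_holomorphy Omega.
Proof.
move=> rho0 nq HO [oO]; apply.
have half (a t : R) : 0 < t -> a < t / 2 -> a < t by lra.
have sum_quarter (a b : R) : a <= rho / 4 -> b <= rho / 4 -> a + b < rho by lra.
have sum_gt0 (a N e t : R) : `|a| <= N -> N <= e -> e <= t / 2 -> 0 < t -> 0 < a + t.
  by rewrite ler_norml => /andP[]; lra.
have Re_gt0 (w : C) (t : R) : complex.Re (- w) < 0 -> 0 < complex.Re w + t ^+ 2.
  by have := sqr_ge0 t; case: w => a b /=; lra.
pose s := rho / (4 * (nrm levi_dir + 1)).
have v0 : 0 < nrm levi_dir + 1 by rewrite ltr_wpDl ?nrm_ge0.
have s0 : 0 < s by rewrite divr_gt0// mulr_gt0.
have sv : s * nrm levi_dir <= rho / 4.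
  have -> : rho / 4 = s * (nrm levi_dir + 1) by rewrite /s; field; rewrite gt_eqF.
  by rewrite ler_wpM2l ?(ltW s0)// lerDl.
(* eta bounds the transverse part: less than s^2 for the circles to be in Omega *)
pose eta := Num.min (rho / 4) (s ^+ 2 / 2).
have s20 : 0 < s ^+ 2 by rewrite exprn_gt0.
have eta0 : 0 < eta by rewrite lt_min !divr_gt0.
have etar : eta <= rho / 4 by rewrite ge_min lexx.
have etas : eta <= s ^+ 2 / 2 by rewrite ge_min lexx orbT.
have near x : nrm (axial x) <= s -> nrm (transverse x) <= eta -> nrm (x - q) < rho.
  move=> xs xe; have -> : x - q = axial x *: levi_dir + transverse x.
    by apply/eqP; rewrite subr_eq [eqbRHS]addrC addrA -splitE.
  apply: le_lt_trans (nrmD _ _) _; rewrite (nrmZ (axial x)).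
  have xv := ler_wpM2r (nrm_ge0 levi_dir) xs.
  exact: sum_quarter (le_trans xv sv) (le_trans xe etar).
have inO x : nrm (axial x) <= s -> nrm (transverse x) <= eta ->
    0 < complex.Re (transverse x ord0 i0) + nrm (axial x) ^+ 2 -> Omega x.
  by move=> xs xe x0; apply: HO; [exact: near|rewrite -subr_gt0 paraboloidE].
have torus x : nrm (axial x) = s -> nrm (transverse x) <= eta -> Omega x.
  move=> xs xe; apply: inO => //; first by rewrite xs.
  rewrite xs; apply: sum_gt0 (nrm_Re _) _ etas s20.
  exact: le_trans (nrm_coord _ _) xe.
pose U2 := [set x | nrm (transverse x) < eta] `&` [set x | nrm (axial x) < s / 2].
pose U1 := U2 `&` [set x | complex.Re (- transverse x ord0 i0) < 0].
have ct : continuous (fun x => nrm (transverse x)).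
  move=> x; apply: (@continuous_comp _ _ _ transverse (@nrm R 'rV[C]_n)).
    exact: transverse_continuous.
  exact: nrm_continuous.
have ca : continuous (fun x => nrm (axial x)).
  move=> x; apply: (@continuous_comp _ _ _ axial (@nrm R C)).
    exact: axial_continuous.
  exact: nrm_continuous.
have oU2 : open U2.
  by apply: openI; exact: open_lt_continuous.
have oU1 : open U1.
  apply: openI => //; apply: open_lt_continuous => x.
  apply: (@continuous_comp _ _ _ (fun x => - transverse x ord0 i0)); last exact: Re_continuous.
  move: x; apply: (@nrm_lipschitz_continuous R _ _ _ (1 + nrm levi_dir)) => x y.
  apply: le_trans (transverse_lipschitz x y).
  move: (transverse y) (transverse x) => a b.
  have -> : - a ord0 i0 - - b ord0 i0 = - ((a - b) ord0 i0) by rewrite !mxE; ring.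
  by rewrite nrmN nrm_coord.
have tq : transverse q = 0 by rewrite /transverse subrr linear0.
have aq : axial q = 0 by rewrite /axial subrr.
have U2q : U2 q by split; rewrite /= ?tq ?aq nrm0// divr_gt0.
have U1U2 : U1 `<=` U2 `&` Omega.
  move=> x [[/= xe xs] x0]; split=> //; apply: inO; [|exact: ltW|exact: Re_gt0].
  exact/ltW/half.
exists U1, U2; split=> //.
(* U1 contains the points pushed off q in the direction where the paraboloid grows *)
- split=> //; exists (q + 0 *: levi_dir + rC (eta / 2) *: delta_mx ord0 i0).
  have h1 : (rC (eta / 2) *: delta_mx ord0 i0 : 'rV[C]_n) ord0 i1 = 0.
    by rewrite !mxE eqxx eq_sym (negbTE i01) mulr0.
  have he : 0 < eta / 2 by rewrite divr_gt0.
  split; [split|]; rewrite /= ?transverse_levi ?axial_levi//.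
  + rewrite nrmZ nrm_rC gtr0_norm//.
    have : nrm (delta_mx ord0 i0 : 'rV[C]_n) <= 1.
      exact: nrm_delta_le1.
    move=> /(ler_wpM2l (ltW he)) /le_lt_trans; apply; rewrite mulr1.
    by rewrite ltr_pdivrMr// ltr_pMr// ltr1n.
  + by rewrite nrm0 divr_gt0.
  + by rewrite !mxE !eqxx mulr1 /= oppr_lt0.
- by split=> //; exists q.
- split; last by move=> /(_ _ U2q).
  apply: convex_connected => x y t [/= x1 x2] [/= y1 y2] /andP[t0 t1].
  have t01 : 0 <= t <= 1 by rewrite t0 t1.
  split=> /=.
    rewrite transverse_affine.
    exact: convex_nrm_lt.
  rewrite axial_affine; exact: convex_nrm_lt.
move=> f hf.
pose W := ([set x | nrm (transverse x) <= eta] `&` [set x | nrm (axial x) <= s]) `&`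
   [set x | s <= nrm (axial x)].
have cW : compact W.
  apply: (@closed_bounded_compact _ _ _ (nrm q + rho)).
    by apply: closedI; [apply: closedI; exact: closed_le_continuous|exact: closed_ge_continuous].
  move=> x [[/= h1 h2] _]; rewrite -[x](subrK q) addrC.
  by apply: le_trans (nrmD _ _) _; rewrite lerD2l ltW// near.
have [B HB] : exists B : R, forall x, W x -> nrm (f x) <= B.
  apply: compact_image_bounded cW _ => x [[/= h1 h2] h3].
  apply/(cvg_nrm f); apply: differentiable_continuous; apply: hf.
  by apply: torus => //; apply/eqP; rewrite eq_le h2 h3.
pose F m z := disc_mean s f m z.
have onW z (t : C) : U2 z -> nrm t = s -> W (q + t *: levi_dir + transverse z).
  move=> [/= z1 z2] ts; split; [split|] => /=; rewrite ?transverse_levi ?axial_levi ?transverse1 ?ts//.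
  exact: ltW.
have dF m z : U2 z -> differentiable (F m) z.
  move=> Uz; have [z1 z2] := Uz.
  apply: disc_mean_differentiable => //; first exact: half.
  move=> t /(onW _ _ Uz)[[w1 w2] w3]; apply: hf; apply: torus => //.
  by apply/eqP; rewrite eq_le w2 w3.
have FB m z : U2 z -> nrm (F m z) <= 2 * B.
  move=> Uz; have [z1 z2] := Uz.
  by apply: disc_mean_bound => // t /(onW _ _ Uz); exact: HB.
have [U [UU Uoo]] := @ultraFilterLemma nat \oo _.
have /choice[G HG] : forall z, exists l : C, U2 z -> F m z @[m --> U] --> l.
  move=> z; have [Uz|nUz] := pselect (U2 z); last by exists 0.
  have [l Hl] := @ultra_cvg_bounded R nat U (fun m => F m z) (2 * B) UU (fun m => FB m z Uz).
  by exists l.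
exists G; split.
  move=> z Uz; have /nbhs_nrm[r r0 Hr] : nbhs z U2 by exact: open_nbhs_nbhs.
  apply: (@ultralimit_differentiable _ _ U F G z r (2 * B) UU r0).
  - by move=> m w /Hr; exact: dF.
  - by move=> m w /Hr; exact: FB.
  - by move=> w /Hr; exact: HG.
move=> z U1z; have [[/= z1 z2] z3] := U1z; have [Uz _] := U1U2 _ U1z.
have z2' : nrm (axial z) < s by exact: half.
have V : vanishes (fun m => F m z - f z).
  have := @cauchy_formula R s (fun t => f (q + t *: levi_dir + transverse z)) (axial z) s0 z2'.
  rewrite -splitE; apply => t ts.
  have : Omega (q + t *: levi_dir + transverse z).
    apply: inO; rewrite ?transverse_levi ?axial_levi ?transverse1 ?(ltW z1)//.
    exact: Re_gt0.
  move=> /hf /differentiable_frechet H.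
  exists (lincomb (fun i => 'd f (q + t *: levi_dir + transverse z) (delta_mx ord0 i)) levi_dir).
  have E (x : C) : q + transverse z + x *: levi_dir = q + x *: levi_dir + transverse z.
    exact: addrAC.
  move=> e e0; have := @frechet_line _ _ f (q + transverse z) _ levi_dir t.
  rewrite E => /(_ _ H e e0)[d d0 Hd]; exists d => // x /Hd.
  by rewrite E.
have : F m z @[m --> \oo] --> f z.
  move=> A /nbhs_nrm[e e0 eA]; have [M HM] := V e e0.
  by exists M => // m /= /HM; exact: eA.
move=> H; have Uf : F m z @[m --> U] --> f z by move=> A /H; exact: Uoo.
exact: norm_cvg_unique (HG z Uz) Uf.
Qed.

End Hartogs.

(** * Separation and boundary crossing *)
Section Separation.
Context {R : realType} {V : normedModType (Cplx R)}.
Implicit Types (x y z : V) (A Omega : set V).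

(** The closed ball of center [x] through [z] is connected and meets both [Omega] and
its complement. *)
Lemma boundary_crossing Omega x z : open Omega -> Omega x -> ~ Omega z ->
  exists2 b, (closure Omega `\` Omega) b & nrm (b - x) <= nrm (z - x).
Proof.
move=> oO Ox nz; apply: contrapT => no.
pose S := [set w | nrm (w - x) <= nrm (z - x)].
have cS : connected S.
  apply: convex_connected => a b t /= ax bx t01; rewrite /S /=.
  have -> : a + rC t *: (b - a) - x = (a - x) + rC t *: ((b - x) - (a - x)).
    by rewrite addrAC opprB (addrA _ x) subrK.
  exact: convex_nrm_le.
have : S `&` Omega = S.
  apply: cS.
  - by exists x; split=> //; rewrite /S /= subrr nrm0 nrm_ge0.
  - by exists Omega.
  - exists (closure Omega); first exact: closed_closure.
    apply/seteqP; split=> w [Sw Ow]; split=> //; first exact: subset_closure.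
    by apply: contrapT => nOw; apply: no; exists w.
move=> SO; apply: nz; have [] : (S `&` Omega) z by rewrite SO /S /=.
by [].
Qed.

Lemma open_near_union A (d : R) : open [set z | exists2 w, A w & nrm (z - w) < d].
Proof.
rewrite openE => z [w Aw zw]; apply/nbhs_nrm.
exists (d - nrm (z - w)); first by rewrite subr_gt0.
move=> y yz; exists w => //; have := nrm_triB y z w; lra.
Qed.

Lemma connected_locally_constant (T : Type) A (g : V -> T) (d : R) :
  0 < d -> connected A ->
  (forall x y, A x -> A y -> nrm (y - x) < d -> g x = g y) ->
  forall x y, A x -> A y -> g x = g y.
Proof.
move=> d0 cA gd x y Ax Ay.
pose B := [set z | A z /\ g z = g x].
have near w : nrm (w - w) < d by rewrite subrr nrm0.
have : B = A.
  apply: cA.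
  - by exists x.
  - exists [set z | exists2 w, B w & nrm (z - w) < d]; first exact: open_near_union.
    apply/seteqP; split=> [z [Az gz]|z [Az [w [Aw gw] zw]]]; first by split=> //; exists z.
    by split=> //; rewrite -gw; apply/esym/gd.
  - exists (~` [set z | exists2 w, (A `\` B) w & nrm (z - w) < d]).
      exact/open_closedC/open_near_union.
    apply/seteqP; split=> [z [Az gz]|z [Az nz]].
      split=> // -[w [Aw nBw] zw]; apply: nBw; split=> //.
      by rewrite -gz; exact: gd.
    by split=> //; apply: contrapT => gz; apply: nz; exists z => //; split=> // -[].
by move=> BA; move: Ay; rewrite -BA => -[_ ->].
Qed.

Lemma closed_disjoint_dist A (K : set V) : compact A -> closed K ->
  (forall x, A x -> ~ K x) ->
  exists2 d : R, 0 < d & forall x y, A x -> K y -> d <= nrm (y - x).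
Proof.
move=> cA cK AK.
have [|d d0 H] := compact_uniform (P := fun e x => forall y, K y -> e <= nrm (y - x)) cA.
  move=> x Ax.
  have /nbhs_nrm[r r0 Hr] : nbhs x (~` K).
    by apply: open_nbhs_nbhs; split; [exact: closed_openC|exact: AK].
  exists (r / 2); first by rewrite divr_gt0.
  move=> y e yx /andP[_ er] w Kw; rewrite leNgt; apply/negP => wy.
  by apply: (Hr w _ Kw); have := nrm_triB w y x; lra.
by exists d => // x y Ax; exact: H.
Qed.

End Separation.

(** * The height: a primitive of the boundary jumps *)
Section Height.
Context {R : realType} {n : nat}.
Local Notation C := (Cplx R).
Implicit Types (x y z : 'rV[C]_n).
Variables (Omega : set 'rV[C]_n) (chi : 'rV[C]_n -> int) (d : R) (i0 : 'I_n).
Hypothesis chi_jump : forall x y z, Omega x -> Omega y -> ~ Omega z ->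
  nrm (x - z) < d -> nrm (x - y) < d -> chi x = chi y.

(** The increments of [chi], except that those across the boundary of [Omega], or
along its complement, count for nothing; this is why [chi] itself is not a
primitive of [jump]. *)
Definition jump x y : int :=
  if `[< Omega x /\ Omega y >] then chi x - chi y else 0.

Lemma jump_in x y : Omega x -> Omega y -> jump x y = chi x - chi y.
Proof. by move=> Ox Oy; rewrite /jump; case: asboolP => // -[]. Qed.

Lemma jump_outl x y : ~ Omega x -> jump x y = 0.
Proof. by move=> Ox; rewrite /jump; case: asboolP => // -[]. Qed.

Lemma jump_outr x y : ~ Omega y -> jump x y = 0.
Proof. by move=> Ox; rewrite /jump; case: asboolP => // -[]. Qed.

(** If one of the three points is outside [Omega], then [chi] takes the same value at
those of them that are in [Omega], by [chi_jump]. *)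
Lemma jump_cocycle x y z : nrm (x - y) < d -> nrm (y - z) < d -> nrm (x - z) < d ->
  jump x y + jump y z = jump x z.
Proof.
move=> xy yz xz.
have [Ox|nOx] := pselect (Omega x); have [Oy|nOy] := pselect (Omega y);
  have [Oz|nOz] := pselect (Omega z).
- by rewrite !jump_in// addrA subrK.
- by rewrite jump_in// !jump_outr// (chi_jump Ox Oy nOz)// subrr addr0.
- have E := chi_jump Ox Oz nOy xy xz.
  by rewrite (jump_outr _ nOy) (jump_outl _ nOy) (jump_in Ox Oz) E (subrr (chi z)).
- by rewrite (jump_outr _ nOy) (jump_outl _ nOy) jump_outr.
- have yx : nrm (y - x) < d by rewrite nrmB; exact: xy.
  by rewrite !(jump_outl _ nOx) (jump_in Oy Oz) (chi_jump Oy Oz nOx yx yz) (subrr (chi z)).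
- by rewrite !(jump_outl _ nOx) jump_outr.
- by rewrite !(jump_outl _ nOx) (jump_outl _ nOy).
- by rewrite !(jump_outl _ nOx) (jump_outl _ nOy).
Qed.

Variables (s : R) (N : nat).
Hypotheses (s0 : 0 < s) (sd : s < d / 2).

(** The direction is that along which [paraboloid] increases at unit speed: above a
given level, a number of steps independent of the point leaves a bounded set. *)
Definition ray k x : 'rV[C]_n := x + rC (k%:R * s) *: delta_mx ord0 i0.

Definition height x : int := \sum_(k < N) jump (ray k x) (ray k.+1 x).

Lemma ray_step k x : nrm (ray k x - ray k.+1 x) <= s.
Proof.
rewrite /ray opprD addrACA subrr add0r -scalerBl -rmorphB /= -mulrBl.
rewrite -natr1 opprD addrA subrr add0r mulN1r nrmZ nrm_rC normrN gtr0_norm//.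
by rewrite ler_piMr ?nrm_delta_le1// ltW.
Qed.

Lemma ray_dist k x y : ray k x - ray k y = x - y.
Proof. by rewrite /ray opprD addrACA subrr addr0. Qed.

(** The cocycle relation on the thin quadrangles between the rays from [x] and from
[y] makes the sum telescope; the far end contributes nothing because it is outside
[Omega]. *)
Lemma heightB x y : nrm (x - y) < d / 2 -> ~ Omega (ray N x) ->
  height x - height y = jump x y.
Proof.
move=> xy nO; rewrite /height -sumrB.
have lin (a b c e t : int) : a + b = t -> c + e = t -> c - b = a - e.
  by move=> <- h; apply/eqP; rewrite subr_eq addrAC eq_sym subr_eq h.
have d0 : 0 < d / 2 by exact: lt_trans sd.
have dd : d / 2 < d by rewrite [ltRHS]splitr ltrDl.
have sd' : s < d by exact: lt_trans dd.
have hxy k : nrm (ray k x - ray k y) < d by rewrite ray_dist (lt_trans xy).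
have hstep k z : nrm (ray k z - ray k.+1 z) < d by exact: le_lt_trans (ray_step k z) sd'.
pose f k := jump (ray k x) (ray k y).
have fN : f N = 0 by exact: jump_outl.
have f0 : f 0%N = jump x y by rewrite /f /ray mul0r rmorph0 scale0r !addr0.
transitivity (\sum_(k < N) (f k - f k.+1)).
  apply: eq_bigr => k _.
  have h1 : nrm (ray k x - ray k.+1 y) < d.
    apply: le_lt_trans (nrm_triB _ (ray k y) _) _; rewrite ray_dist (splitr d).
    exact: ltrD xy (le_lt_trans (ray_step k y) sd).
  exact: lin (jump_cocycle (hxy k) (hstep k y) h1) (jump_cocycle (hstep k x) (hxy k.+1) h1).
rewrite -f0; clearbody f; rewrite -(big_mkord predT (fun k => f k - f k.+1)).
under eq_bigr do rewrite -opprB.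
by rewrite sumrN telescope_sumr// fN sub0r opprK.
Qed.

Lemma height_neq0 x : height x != 0 -> exists k, Omega (ray k x).
Proof.
move=> hx; apply: contrapT => no; move/eqP: hx; apply.
by rewrite /height big1// => k _; apply: jump_outl => Ox; apply: no; exists k.
Qed.

End Height.

(** * An exposed point of the complement *)
Section Exposed.
Context {R : realType} {n : nat}.
Local Notation C := (Cplx R).
Implicit Types (x y z : 'rV[C]_n).

Lemma paraboloid_continuous (i0 i1 : 'I_n) : continuous (paraboloid i0 i1 : 'rV[C]_n -> R).
Proof.
have cc (i : 'I_n) : continuous (fun x : 'rV[C]_n => x ord0 i).
  by move=> x; exact: coord_continuous.
have cRe : continuous (fun x : 'rV[C]_n => complex.Re (x ord0 i0)).
  by move=> x A /(@Re_continuous R) /(cc i0 x).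
have cnrm : continuous (fun x : 'rV[C]_n => nrm (x ord0 i1)).
  by move=> x A /(@nrm_continuous R C) /(cc i1 x).
by move=> x; exact: (cvgD (cRe x) (cvgM (cnrm x) (cnrm x))).
Qed.

(** The bound [- r - r ^+ 2] is the one imposed in [height_eq0] by the level of a point
of the ball of radius [r]. *)
Lemma ray_leaves (i0 : 'I_n) (s r : R) (N : nat) x :
  2 * r + r ^+ 2 < N%:R * s -> - r - r ^+ 2 <= complex.Re (x ord0 i0) ->
  ~ nrm (ray i0 s N x) <= r.
Proof.
move=> NT xr Hr; have := le_trans (nrm_coord _ i0) Hr.
rewrite !mxE !eqxx mulr1 => /(le_trans (nrm_Re _)).
by rewrite ler_norml; case: (x ord0 i0) xr => u v /= xr /andP[]; lra.
Qed.

(** If the height at [a] were not 0, the paraboloid would reach a maximum on the set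
[A] of the points outside [Omega] at the same height and at least at the same
level as [a].  This set is bounded: a ray from a point of [A] meets [Omega], which
bounds all coordinates but the real part of the first one, above by the ray and
below by the level.  A maximum is a point across which [hartogs_extension] applies. *)
Lemma height_eq0 (Omega : set 'rV[C]_n) (chi : 'rV[C]_n -> int) (d s r : R) (N : nat)
    (i0 i1 : 'I_n) a :
  i0 != i1 -> 0 < s -> s < d / 2 ->
  (forall x y z, Omega x -> Omega y -> ~ Omega z ->
    nrm (x - z) < d -> nrm (x - y) < d -> chi x = chi y) ->
  domain_of_holomorphy Omega -> 0 <= r -> (forall x, Omega x -> nrm x <= r) ->
  2 * r + r ^+ 2 < N%:R * s ->
  ~ Omega a -> nrm a <= r -> height Omega chi i0 s N a = 0.
Proof.
move=> i01 s0 sd jmp dO r0 Or NT nOa ar.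
pose h := height Omega chi i0 s N; rewrite -/(h a).
pose ph : 'rV[C]_n -> R := paraboloid i0 i1.
have [oO _] := dO.
apply/eqP; apply: contrapT => /negP ha.
have far x : - r - r ^+ 2 <= complex.Re (x ord0 i0) -> ~ Omega (ray i0 s N x).
  by move=> xr /Or; exact: ray_leaves.
have low x : h x = h a -> ph a <= ph x -> - r - r ^+ 2 <= complex.Re (x ord0 i0).
  move=> hx px; have [k /Or Hk] : exists k, Omega (ray i0 s k x).
    by apply: (@height_neq0 _ _ _ chi i0 s N); rewrite -/(h x) hx.
  have := le_trans (nrm_coord _ i1) Hk.
  rewrite !mxE eqxx (eq_sym i1) (negbTE i01) mulr0 addr0 => x1.
  have := le_trans (nrm_Re _) (le_trans (nrm_coord _ i0) ar).
  rewrite ler_norml => /andP[a0 _].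
  have xx : nrm (x ord0 i1) ^+ 2 <= r ^+ 2 by rewrite lerXn2r ?nnegrE ?nrm_ge0.
  have aa : 0 <= nrm (a ord0 i1) ^+ 2 by rewrite sqr_ge0.
  by move: px; rewrite /ph /paraboloid; lra.
have d0 : 0 < d / 2 by exact: lt_trans sd.
have locc x y : - r - r ^+ 2 <= complex.Re (x ord0 i0) -> ~ Omega x ->
    nrm (x - y) < d / 2 -> h x = h y.
  move=> xr nOx xy; apply/eqP; rewrite -subr_eq0; apply/eqP.
  by rewrite /h (heightB jmp s0 sd xy (far _ xr)) jump_outl.
pose A := [set x | [/\ ~ Omega x, h x = h a & ph a <= ph x]].
have cA : closed A.
  move=> x clx.
  have [y [nOy hy py] yx] := closure_nrm clx d0.
  split.
  - move=> Ox; have [z [[nOz _ _] Oz]] := clx Omega (open_nbhs_nbhs (conj oO Ox)).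
    exact: nOz.
  - by rewrite -(locc y x)//; exact: low.
  - have cP : closed [set x | ph a <= ph x].
      by apply: closed_ge_continuous; exact: paraboloid_continuous.
    by apply: cP; apply: closureS clx => z [].
have kA : compact A.
  apply: (closed_bounded_compact (r := 2 * r + (r + r ^+ 2))) => // x [nOx hx px].
  have lo := low _ hx px.
  have [k /Or Hk] : exists k, Omega (ray i0 s k x).
    by apply: (@height_neq0 _ _ _ chi i0 s N); rewrite -/(h x) hx.
  have r20 : 0 <= r ^+ 2 by exact: sqr_ge0.
  apply: nrm_rV_le => [|j]; first lra.
  have := le_trans (nrm_coord _ j) Hk; rewrite !mxE eqxx.
  have [->|ji] := eqVneq j i0; last by rewrite mulr0 addr0; lra.
  rewrite mulr1 => H; have hre := le_trans (nrm_Re _) H.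
  have him := le_trans (nrm_Im _) H; apply: le_trans (nrm_le_ReIm _) _.
  have ks0 : 0 <= k%:R * s by rewrite mulr_ge0// ltW.
  move: ks0 hre him lo; move: (k%:R * s) => ks ks0.
  case: (x ord0 i0) => u v /=; rewrite addr0 => hre him lo.
  have : `|u| <= r + r ^+ 2 by move: hre; rewrite !ler_norml => /andP[]; lra.
  lra.
have A0 : A !=set0 by exists a.
have cph : {within A, continuous ph}.
  exact/continuous_subspaceT/paraboloid_continuous.
have [q] := compact_EVT_max A0 kA cph.
rewrite inE => -[nOq hq pq] max.
apply: (@hartogs_extension _ _ _ _ i01 q Omega (d / 2)) => // x xq px.
apply: contrapT => nOx.
have qx : h q = h x by apply: locc; [exact: low|by []|rewrite nrmB].
have Ax : A x by split=> //; [rewrite -qx|exact: le_trans pq (ltW px)].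
by have := max x (mem_set Ax); rewrite leNgt -/ph px.
Qed.

End Exposed.

(** * Connectedness of the boundary *)
Theorem theorem1p1 (R : realType) (n : nat) (hn : (2 <= n)%N)
    (Omega : set 'rV[Cplx R]_n)
    (hconn : connected Omega)
    (hbnd : bounded_set Omega)
    (hdom : domain_of_holomorphy Omega) :
  connected (boundary Omega).
Proof.
pose i0 : 'I_n := Ordinal (ltnW hn); pose i1 : 'I_n := Ordinal hn.
have i01 : i0 != i1 by [].
have [oO _] := hdom.
have bE : boundary Omega = closure Omega `\` Omega.
  by rewrite /boundary (interior_id _).1.
have [r [r0 Or]] : exists r : R, 0 <= r /\ forall x, closure Omega x -> nrm x <= r.
  have [M HM] := bounded_nrm hbnd; exists `|M|; split=> // x clx.
  have cl : closed [set x : 'rV[Cplx R]_n | nrm x <= `|M|].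
    by apply: closed_le_continuous; exact: nrm_continuous.
  apply: cl; apply: closureS clx => y Oy /=.
  exact: le_trans (HM y Oy) (ler_norm M).
have Or' x : Omega x -> nrm x <= r by move=> Ox; apply: Or; exact: subset_closure.
have cb : closed (boundary Omega).
  by rewrite bE setDE; apply: closedI; [exact: closed_closure|exact: open_closedC].
have bOut x : boundary Omega x -> ~ Omega x by rewrite bE => -[].
have bcl x : boundary Omega x -> closure Omega x by rewrite bE => -[].
move=> K1 [k1 K1k1] [U oU K1U] [D cD K1D].
apply/seteqP; split=> [x|k2 bk2]; first by rewrite K1U => -[].
apply: contrapT => nk2.
pose K2 := boundary Omega `&` ~` U.
have K1b x : K1 x -> boundary Omega x by rewrite K1U => -[].
have K12 x : boundary Omega x -> K1 x \/ K2 x.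
  move=> bx; have [Ux|nUx] := pselect (U x); [left; rewrite K1U|right]; by split.
have K2k2 : K2 k2 by have [] := K12 _ bk2.
have cK1 : compact K1.
  apply: (closed_bounded_compact (r := r)) => [|x /K1b /bcl]; last exact: Or.
  by rewrite K1D; exact: closedI.
have cK2 : closed K2 by apply: closedI => //; exact: open_closedC.
have [d4 d40 sep] : exists2 d : R, 0 < d & forall x y, K1 x -> K2 y -> d <= nrm (y - x).
  by apply: closed_disjoint_dist => // x; rewrite K1U => -[_ Ux] [_].
pose d := d4 / 4.
have d0 : 0 < d by rewrite divr_gt0.
have dE : d4 = 4 * d by rewrite /d; field.
clearbody d; rewrite {}dE {d4 d40} in sep.
have lt2 (a b : R) : a < d -> b < d -> a + b < 2 * d by lra.
have lt1 (a : R) : a < d -> a < 2 * d by lra.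
have half : d / 2 < d by lra.
have d22 : 2 * d + 2 * d = 4 * d by ring.
pose close x := exists2 k, K1 k & nrm (x - k) < 2 * d.
(* the factor 2 leaves room for a neighbour of a point close to the boundary *)
pose chi x : int := (`[< close x >] : nat)%:Z.
have chi1 x k : K1 k -> nrm (x - k) < 2 * d -> chi x = 1.
  by move=> Kk xk; rewrite /chi asboolT//; exists k.
have chi0 x k : K2 k -> nrm (x - k) < 2 * d -> chi x = 0.
  move=> Kk xk; rewrite /chi asboolF// => -[k' Kk' xk'].
  have := le_trans (sep _ _ Kk' Kk) (nrm_triB k x k'); rewrite (nrmB k x).
  by move=> /le_lt_trans/(_ (ltrD xk xk')); rewrite d22 ltxx.
have jmp x y z : Omega x -> Omega y -> ~ Omega z ->
    nrm (x - z) < d -> nrm (x - y) < d -> chi x = chi y.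
  move=> Ox Oy nOz xz xy.
  have [b bb bx] := boundary_crossing oO Ox nOz; rewrite -bE in bb.
  rewrite (nrmB z) (nrmB b) in bx.
  have xb : nrm (x - b) < 2 * d by exact/lt1/(le_lt_trans bx).
  have yb : nrm (y - b) < 2 * d.
    apply: le_lt_trans (nrm_triB y x b) _; rewrite (nrmB y x).
    exact: lt2 xy (le_lt_trans bx xz).
  by have [Kb|Kb] := K12 _ bb;
    [rewrite (chi1 _ _ Kb xb) (chi1 _ _ Kb yb)|rewrite (chi0 _ _ Kb xb) (chi0 _ _ Kb yb)].
pose s := d / 4; have s0 : 0 < s by rewrite divr_gt0.
have sd : s < d / 2 by rewrite /s; lra.
have [N NT] : exists N, 2 * r + r ^+ 2 < N%:R * s.
  have p0 : 0 <= (2 * r + r ^+ 2) / s.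
    by rewrite divr_ge0 ?(ltW s0)// addr_ge0 ?mulr_ge0// exprn_ge0.
  by exists (Num.bound ((2 * r + r ^+ 2) / s)); rewrite -ltr_pdivrMr// archi_boundP.
have d20 : 0 < d / 2 by rewrite divr_gt0.
have far x : nrm x <= r -> ~ Omega (ray i0 s N x).
  move=> xr /Or'; apply: ray_leaves => //.
  have := le_trans (nrm_Re _) (le_trans (nrm_coord _ i0) xr).
  by rewrite ler_norml => /andP[+ _]; have := sqr_ge0 r; lra.
pose h := height Omega chi i0 s N.
have h0 k : boundary Omega k -> h k = 0.
  move=> bk; apply: (@height_eq0 _ _ Omega chi d s r N i0 i1) => //.
    exact: bOut.
  exact/Or/bcl.
have hB x y : nrm x <= r -> nrm (x - y) < d / 2 -> h x - h y = jump Omega chi x y.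
  by move=> xr xy; apply: (@heightB _ _ Omega chi d i0 jmp s N) => //; exact: far.
have near k : boundary Omega k -> exists x, [/\ Omega x, nrm (x - k) < d / 2 & h x = 0].
  move=> bk; have [x Ox xk] := closure_nrm (bcl _ bk) d20.
  exists x; split=> //; have := hB _ _ (Or' _ Ox) xk.
  by rewrite (h0 _ bk) subr0 (jump_outr _ _ (bOut _ bk)).
have lin (a b c e : int) : a - b = c - e -> a - c = b - e.
  by move=> E; rewrite -[a in LHS](subrK b) E; ring.
(* on Omega, the height has the same small increments as chi *)
have gc x y : Omega x -> Omega y -> h x - chi x = h y - chi y.
  move=> Ox Oy; apply: (@connected_locally_constant _ _ _ Omega (fun x => h x - chi x) _ d20 hconn _ x y Ox Oy).
  move=> {Ox Oy}x {}y Ox Oy; rewrite nrmB => xy.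
  have := hB _ _ (Or' _ Ox) xy; rewrite (jump_in _ Ox Oy) => E.
  exact: lin E.
have [x1 [Ox1 xk1 hx1]] := near _ (K1b _ K1k1).
have [x2 [Ox2 xk2 hx2]] := near _ bk2.
have c1 : chi x1 = 1 by apply: (chi1 _ _ K1k1); exact/lt1/(lt_trans xk1).
have c2 : chi x2 = 0 by apply: (chi0 _ _ K2k2); exact/lt1/(lt_trans xk2).
by have := gc _ _ Ox1 Ox2; rewrite hx1 hx2 c1 c2.
Qed.
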